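(* Let $I$ be a non-empty open interval of $\mathbb{R}$ and let $\lambda_1,\lambda_2$ be probability measures on $\mathcal{B}_I$ of finite mean. Assume $\lambda_1$ has finite support; let $A:=\operatorname{supp}(\lambda_1)$ and $n:=|A|$. Then for any given measure $\nu$ on $\mathcal{B}_{I^2}$ the following are equivalent: (i) $\nu$ is a curtain martingale coupling of $\lambda_1$ and $\lambda_2$. (ii) There exists a bijection $J:\{1,\ldots,n\}\to A$ such that $\nu=\delta_{J(1)}\times\nu_1+\cdots+\delta_{J(n)}\times\nu_n$, where inductively, for $i\in\{1,\ldots,n\}$, $\nu_i$ is the unique connected part of $\lambda_2-(\nu_1+\cdots+\nu_{i-1})$ of mass $\lambda_1(\{J(i)\})$ and first moment $\lambda_1(\{J(i)\})J(i)$. (iii) For some strictly concave $f:I\to\mathbb{R}$ with $\int f^-\,d\lambda_2<\infty$ and some bounded Borel $g:I\to\mathbb{R}$ that is injective on $A$, $\nu$ is a martingale transport of $\lambda_1$ to $\lambda_2$ that maximizes $\int (g\otimes f)\,d\rho$ over all martingale transports $\rho$ of $\lambda_1$ to $\lambda_2$. (iii') The same as (iii), but with ''maximizes'' replaced by ''uniquely maximizes''.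
   Context: $\mathcal{B}_A$ denotes the Borel $\sigma$-field of $A$; $\delta_x$ is the Dirac measure at $x$. $X_1,X_2$ are the canonical projections of $I^2$ onto the first and second coordinate. For $g,f:I\to\mathbb{R}$, $(g\otimes f)(x,y):=g(x)f(y)$ for $(x,y)\in I^2$. A martingale coupling of $\lambda_1$ and $\lambda_2$ (synonym: martingale transport of $\lambda_1$ to $\lambda_2$) is a probability measure $\nu$ on $\mathcal{B}_{I^2}$ with first marginal $\lambda_1$, second marginal $\lambda_2$ and $E_\nu[X_2\mid X_1]=X_1$ $\nu$-a.s. A curtain martingale coupling of $\lambda_1$ and $\lambda_2$ is a martingale coupling $\nu$ of $\lambda_1$ and $\lambda_2$ for which there exists $\Gamma\in\mathcal{B}_{I^2}$ that carries $\nu$ (i.e. $\nu(\Gamma)=1$) and such that one cannot have $\{(x,y),(x,y_1),(x,y_2),(x',y'),(x',y_1'),(x',y_2')\}\subset\Gamma$ with $x\ne x'$, $y_1<y'<y_2$ and $y_1'<y<y_2'$. Connected part: for a finite measure $\gamma$ on $\mathcal{B}_I$ and reals $0\le a\le b\le\gamma(I)$, $\gamma_a^b$ is the unique measure $\rho$ on $\mathcal{B}_I$ with $\rho((-\infty,x]\cap I)=(\gamma((-\infty,x]\cap I)-a)^+\wedge(b-a)$ for all $x\in I$ (the restriction of $\gamma$ between the quantiles $a$ and $b$). A connected part of $\gamma$ is any measure of the form $\gamma_a^b$ with $0\le a\le b\le\gamma(I)$. If $\gamma$ has finite first moment, there is at most one connected part of $\gamma$ with a given mass and given first moment (the first moment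 of a measure $\rho$ being $\int y\,\rho(dy)$). Existence of the connected parts appearing in (ii) is part of condition (ii). *)

(* Defs.v *)
From HB Require Import structures.
From mathcomp Require Import all_boot all_order all_algebra.
From mathcomp Require Import all_classical all_reals all_analysis.

Set Implicit Arguments.
Unset Strict Implicit.
Unset Printing Implicit Defensive.

Import Order.TTheory GRing.Theory Num.Theory.
Import numFieldNormedType.Exports.

Local Open Scope classical_set_scope.
Local Open Scope ring_scope.
Local Open Scope ereal_scope.

(* A measure on the Borel sets of I (resp. I^2) is represented by the Borel
   measure on R (resp. R * R) that it induces, i.e. one vanishing off I
   (resp. I `*` I).  Functions on I are total functions on R of which only the
   restriction to I is ever used.  Values of a measure on non-measurable sets
   are unspecified, hence equality of measures is always taken on measurable
   sets only. *)

Definition carried_by d (T : measurableType d) (R : realType)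
    (mu : {measure set T -> \bar R}) (D : set T) : Prop :=
  mu (~` D) = 0.

Definition eq_measure d (T : measurableType d) (R : realType)
    (mu mu' : {measure set T -> \bar R}) : Prop :=
  forall B : set T, measurable B -> mu B = mu' B.

(* The support relative to I: for mu carried by I, mu U = mu (U `&` I). *)
Definition support_in (R : realType) (I : set R)
    (mu : {measure set R -> \bar R}) : set R :=
  [set x | I x /\ forall U : set R, open U -> U x -> 0 < mu U].

Definition finite_mean (R : realType) (mu : {measure set R -> \bar R}) : Prop :=
  mu.-integrable [set: R] (fun x : R => x%:E).

(* Y is a version of the conditional expectation of X given the
   sub-sigma-algebra G. *)
Definition cond_exp_version d (T : measurableType d) (R : realType)
    (mu : {measure set T -> \bar R}) (G : set (set T)) (X Y : T -> R) : Prop :=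
  [/\ mu.-integrable [set: T] (EFin \o X),
      mu.-integrable [set: T] (EFin \o Y),
      forall B : set R, measurable B -> G (Y @^-1` B) &
      forall C : set T, G C ->
        \int[mu]_(w in C) (Y w)%:E = \int[mu]_(w in C) (X w)%:E].

(* The last clause says E[X_2 | X_1] = X_1 almost surely. *)
Definition martingale_coupling (R : realType) (I : set R)
    (lambda1 lambda2 : {measure set R -> \bar R})
    (nu : {measure set (R * R) -> \bar R}) : Prop :=
  [/\ nu [set: R * R] = 1 /\ carried_by nu (I `*` I),
      forall B : set R, measurable B -> nu (fst @^-1` B) = lambda1 B,
      forall B : set R, measurable B -> nu (snd @^-1` B) = lambda2 B &
      cond_exp_version nu (g_sigma_algebra_preimage (fst : R * R -> R))
        (snd : R * R -> R) (fst : R * R -> R)].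

Definition curtain_set (R : realType) (Gamma : set (R * R)) : Prop :=
  forall x y y1 y2 x' y' y1' y2' : R,
    x <> x' -> (y1 < y' < y2)%R -> (y1' < y < y2')%R ->
    ~ ([set (x, y); (x, y1); (x, y2); (x', y'); (x', y1'); (x', y2')]
         `<=` Gamma).

Definition curtain_martingale_coupling (R : realType) (I : set R)
    (lambda1 lambda2 : {measure set R -> \bar R})
    (nu : {measure set (R * R) -> \bar R}) : Prop :=
  martingale_coupling I lambda1 lambda2 nu /\
  exists Gamma : set (R * R),
    [/\ measurable Gamma, Gamma `<=` I `*` I, nu Gamma = 1 &
        curtain_set Gamma].

(* rho = gamma_a^b *)
Definition is_part_between (R : realType) (I : set R)
    (gamma : {measure set R -> \bar R}) (a b : R)
    (rho : {measure set R -> \bar R}) : Prop :=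
  carried_by rho I /\
  forall x : R, I x ->
    rho (`]-oo, x] `&` I) =
      mine (maxe (gamma (`]-oo, x] `&` I) - a%:E) 0) (b - a)%:E.

Definition connected_part (R : realType) (I : set R)
    (gamma rho : {measure set R -> \bar R}) : Prop :=
  exists a b : R,
    [/\ (0 <= a)%R, (a <= b)%R, b%:E <= gamma I &
        is_part_between I gamma a b rho].

Definition connected_part_with (R : realType) (I : set R)
    (gamma : {measure set R -> \bar R}) (m c : \bar R)
    (rho : {measure set R -> \bar R}) : Prop :=
  [/\ connected_part I gamma rho, rho I = m & \int[rho]_(y in I) y%:E = c].

(* The difference lambda2 - (nu_1 + ... + nu_(i-1)) is required to be a
   measure gamma. *)
Definition connected_part_decomposition (R : realType) (I : set R)
    (lambda1 lambda2 : {measure set R -> \bar R}) (n : nat) (A : set R)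
    (nu : {measure set (R * R) -> \bar R}) : Prop :=
  exists (J : 'I_n -> R) (nu_ : 'I_n -> {finite_measure set R -> \bar R}),
    [/\ set_bij [set: 'I_n] A J,
        forall B : set (R * R), measurable B ->
          nu B = \sum_(i < n) (\d_(J i) \x nu_ i) B &
        forall i : 'I_n,
          exists gamma : {finite_measure set R -> \bar R},
          let m := lambda1 [set J i] in
          let c := lambda1 [set J i] * (J i)%:E in
          [/\ forall B : set R, measurable B ->
                gamma B = lambda2 B - \sum_(j < n | (j < i)%N) nu_ j B,
              connected_part_with I gamma m c (nu_ i) &
              forall rho : {finite_measure set R -> \bar R},
                connected_part_with I gamma m c rho ->
                eq_measure rho (nu_ i)]].

Definition strictly_concave_on (R : realType) (I : set R) (f : R -> R) : Prop :=
  forall x y t : R, I x -> I y -> x <> y -> (0 < t < 1)%R ->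
    (t * f x + (1 - t) * f y < f (t * x + (1 - t) * y))%R.

Definition tensor (R : realType) (g f : R -> R) (z : R * R) : R :=
  (g z.1 * f z.2)%R.

Definition maximizing_transport (R : realType) (I : set R)
    (lambda1 lambda2 : {measure set R -> \bar R}) (h : R * R -> R)
    (nu : {measure set (R * R) -> \bar R}) : Prop :=
  martingale_coupling I lambda1 lambda2 nu /\
  forall rho : {measure set (R * R) -> \bar R},
    martingale_coupling I lambda1 lambda2 rho ->
    \int[rho]_(z in I `*` I) (h z)%:E <= \int[nu]_(z in I `*` I) (h z)%:E.

Definition uniquely_maximizing_transport (R : realType) (I : set R)
    (lambda1 lambda2 : {measure set R -> \bar R}) (h : R * R -> R)
    (nu : {measure set (R * R) -> \bar R}) : Prop :=
  maximizing_transport I lambda1 lambda2 h nu /\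
  forall rho : {measure set (R * R) -> \bar R},
    maximizing_transport I lambda1 lambda2 h rho -> eq_measure rho nu.

Definition admissible_pair (R : realType) (I : set R)
    (lambda2 : {measure set R -> \bar R}) (A : set R) (f g : R -> R) : Prop :=
  [/\ strictly_concave_on I f,
      \int[lambda2]_(y in I) ((EFin \o f)^\- y) < +oo,
      measurable_fun I g,
      [bounded g x | x in I] &
      set_inj A g].

(* Main.v *)
(* A coupling nu with finitely supported first marginal is a finite family of
   fibers eta_1, ..., eta_n summing to lambda2, the fiber over J(i) having mass
   lambda1{J(i)} and barycenter J(i). Each of the four conditions is shown to be
   equivalent to the existence of an enumeration J for which the fibers are
   nested: for i < j, eta_j does not charge the open convex hull of the support
   of eta_i.
   - For a curtain coupling, "Gamma_i meets the open hull of Gamma_j" is a strict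
     partial order on the sections of the carrier Gamma; enumerate along it.
   - Nested fibers are connected parts by inspection of distribution functions;
     a connected part is determined by its mass and mean since two of them with
     equal mass have comparable distribution functions.
   - If eta_j charges the open hull of eta_i although g(J(i)) > g(J(j)), moving a
     bit of eta_j lying between two bits of eta_i into the i-th fiber, in exchange
     for these, increases the integral of g (x) f, by strict concavity of f.
   - Conversely, let f(y) = - sqrt(1 + y^2) and let g decrease along J. Nested
     fibers are optimal by duality: there are affine l_i and a function psi with
     g(J(i)) f - l_i <= psi for all i, with equality eta_i-almost everywhere. The
     l_i are found by backward induction, as g(J(i)) f - psi stays concave. *)
Require Import Defs.
From mathcomp Require Import all_boot all_order all_algebra.
From mathcomp Require Import all_classical all_reals all_analysis.
From mathcomp Require Import measurable_realfun ring lra.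

Import Order.TTheory GRing.Theory Num.Theory.
Import numFieldNormedType.Exports.

Set Implicit Arguments.
Unset Strict Implicit.
Unset Printing Implicit Defensive.

Local Open Scope classical_set_scope.
Local Open Scope ring_scope.

(** * Null sets and distribution functions *)

(** Nestedness uses the open hull because fibers may share an endpoint: an atom of [lambda2] at the
    end of a hull can be split between several fibers. Hulls are described by tail masses and
    exclusions hold up to null sets; exact exclusions are restored on [nested_carrier] where a
    pointwise statement is needed. Condition (ii) only implicitly contains that the fibers add up to
    [lambda2]. This is recovered at the last index, whose fiber must be all that remains. In the
    duality an affine function is fitted to a concave one at the ends of a hull. The hull may be
    unbounded and [lambda2] has only a first moment, hence a Lipschitz [f]. The last fiber needs no
    fitting, and no earlier hull is the whole line because the last fiber avoids it. The exchange
    moves three bits of mass under two linear constraints, mass and mean; one degree of freedom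
    remains. From (iii) to (iii') the pair [f], [g] may change: only the order that [g] puts on the
    atoms is kept. Uniqueness holds because every maximizer for a [g] decreasing along [J] is nested
    along [J], and the family nested along a given [J] is unique. *)

Lemma le_measureS d (T : measurableType d) (R : realType)
    (mu : {measure set T -> \bar R}) (A B : set T) :
  measurable A -> measurable B -> A `<=` B -> (mu A <= mu B)%E.
Proof. by move=> mA mB AB; rewrite le_measure ?inE. Qed.

Lemma null_subset d (T : measurableType d) (R : realType)
    (mu : {measure set T -> \bar R}) (A B : set T) :
  measurable A -> measurable B -> A `<=` B -> mu B = 0%E -> mu A = 0%E.
Proof.
move=> mA mB AB B0; apply/eqP; rewrite eq_le measure_ge0 andbT -B0.
exact: le_measureS.
Qed.

(** Lindelöf argument: the null intervals with rational endpoints form a countable family that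
    covers [D]. [F] enumerates them, with [set0] as a filler. *)
Lemma null_of_locally_null (R : realType) (mu : {measure set R -> \bar R})
    (D : set R) :
  measurable D ->
  (forall y, D y -> exists U : set R, [/\ open U, U y & mu U = 0%E]) ->
  mu D = 0%E.
Proof.
move=> mD locD.
pose F (k : nat) : set R :=
  if unpickle k is Some (p, q) then
    if mu `]ratr p, ratr q[%classic == 0%E then `]ratr p, ratr q[%classic
    else set0
  else set0.
have F0 k : mu.-negligible (F k).
  rewrite /F; case: unpickle => [[p q]|]; last exact: negligible_set0.
  by case: ifPn => [/eqP ?|_]; [apply/negligibleP|exact: negligible_set0].
apply: measure_negligible => //.
apply: negligibleS (negligible_bigcup F0) => y Dy.
have [U [oU Uy U0]] := locD y Dy.
have [e e0 eU] : exists2 e : R, 0 < e & `]y - e, y + e[%classic `<=` U.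
  have /nbhs_ballP[e /= e0 be] : nbhs y U by exact: open_nbhs_nbhs.
  by exists e => //; rewrite -ball_itv.
have [p] : exists p : rat, (ratr p : R) \in `]y - e, y[.
  by apply: rat_in_itvoo; lra.
rewrite in_itv/= => /andP[p1 p2].
have [q] : exists q : rat, (ratr q : R) \in `]y, y + e[.
  by apply: rat_in_itvoo; lra.
rewrite in_itv/= => /andP[q1 q2].
have pq0 : mu `]ratr p, ratr q[%classic = 0%E.
  apply: null_subset U0 => //; first exact: open_measurable.
  apply: subset_trans eU => z /=; rewrite !in_itv/= => /andP[z1 z2].
  by apply/andP; split; lra.
have [k Ek] : exists k, unpickle k = Some (p, q).
  by exists (pickle (p, q)); exact: pickleK.
by exists k => //; rewrite /F Ek pq0 eqxx /= in_itv/= p2 q1.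
Qed.

Lemma point_of_non_null (R : realType) (mu : {measure set R -> \bar R})
    (D : set R) :
  measurable D -> mu D != 0%E ->
  exists2 y, D y & forall U : set R, open U -> U y -> (0 < mu U)%E.
Proof.
move=> mD; apply: contra_neqP => H; apply: null_of_locally_null => // y Dy.
apply: contrapT => nU; apply: H; exists y => // U oU Uy.
rewrite lt0e measure_ge0 andbT; apply/eqP => U0.
by apply: nU; exists U.
Qed.

(** Running maxima of an enumeration of the rationals of [I]. Distribution functions are prescribed
    at points of [I] only, so the total mass of [I] has to be reached as a limit from inside. *)
Lemma cofinal_seq (R : realType) (I : set R) : I !=set0 -> open I ->
  exists x : nat -> R, [/\ forall k, I (x k), nondecreasing_seq x &
    forall y, I y -> exists k, y <= x k].
Proof.
move=> [x0 Ix0] oI.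
pose q (k : nat) : R := if unpickle k is Some p then
  (if `[< I (ratr p) >] then ratr p else x0) else x0.
have Iq k : I (q k).
  by rewrite /q; case: unpickle => [p|//]; case: asboolP.
pose x := fix x k := if k is k'.+1 then Num.max (x k') (q k') else x0.
exists x; split.
- by elim=> //= k IH; rewrite /Num.max; case: ifP.
- by apply/nondecreasing_seqP => k /=; rewrite le_max lexx.
- move=> y Iy.
  have /nbhs_ballP[e /= e0] : nbhs y I by exact: open_nbhs_nbhs.
  rewrite ball_itv => be.
  have [p] : exists p : rat, (ratr p : R) \in `]y, y + e[.
    by apply: rat_in_itvoo; lra.
  rewrite in_itv/= => /andP[p1 p2].
  have [k Ek] : exists k, unpickle k = Some p.
    by exists (pickle p); exact: pickleK.
  exists k.+1 => /=; rewrite le_max; apply/orP; right.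
  have Ip : I (ratr p) by apply: be => /=; rewrite in_itv/= p2 andbT; lra.
  by rewrite /q Ek asboolT// ltW.
Qed.

Lemma measure_le_of_cdf (R : realType) (I : set R) (c : \bar R)
    (mu : {measure set R -> \bar R}) : I !=set0 -> open I -> is_interval I ->
  (forall x, I x -> (mu (`]-oo, x] `&` I) <= c)%E) -> (mu I <= c)%E.
Proof.
move=> I0 oI iI muc.
have mI : measurable I by exact: open_measurable.
have [x [Ix ndx xI]] := cofinal_seq I0 oI.
pose F k := `]-oo, x k]%classic `&` I.
have mF k : measurable (F k) by exact: measurableI.
have FI : \bigcup_k F k = I.
  apply/seteqP; split => [y [k _ []]//|y Iy].
  by have [k yk] := xI y Iy; exists k => //; split => //=; rewrite in_itv/=.
have := @nondecreasing_cvg_mu _ _ _ mu F mF.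
rewrite FI => /(_ mI) cF.
have ndF : nondecreasing_seq F.
  move=> a b ab; apply/subsetPset => y [] /=; rewrite !in_itv/= => ya Iy.
  by split => //=; rewrite in_itv/= (le_trans ya)// ndx.
have {}cF := cF ndF.
rewrite -(cvg_lim _ cF)//; apply: lime_le.
  by apply/cvg_ex; eexists; exact: cF.
by apply: nearW => k; exact: muc.
Qed.

Lemma setTC_carried (R : realType) (mu : {measure set R -> \bar R})
    (I B : set R) :
  measurable I -> measurable B -> carried_by mu I -> mu (B `&` I) = mu B.
Proof.
move=> mI mB cI; have mCI := measurableC mI.
have mBCI := measurableI _ _ mB mCI; have mBI := measurableI _ _ mB mI.
rewrite -[in RHS](setIT B) -(setUv I) setIUr measureU//; last first.
  by rewrite setIACA setICr setI0.
by rewrite [X in (_ + X)%E](null_subset mBCI mCI) ?adde0.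
Qed.

(** The closed left rays are stable under intersection, generate the Borel sets and exhaust the
    line. *)
Lemma eq_measure_of_rays (R : realType) (mu mu' : {measure set R -> \bar R}) :
  (mu setT < +oo)%E ->
  (forall x : R, mu `]-oo, x]%classic = mu' `]-oo, x]%classic) ->
  Defs.eq_measure mu mu'.
Proof.
move=> fin_mu H B mB.
pose G : set (set R) := [set A | exists x : R, A = `]-oo, x]%classic].
have GE : measurable = <<s G >> :> set (set R).
  apply/seteqP; split => A; last first.
    apply: smallest_sub; first exact: sigma_algebra_measurable.
    by move=> _ /= [x ->]; exact: measurable_itv.
  rewrite -[measurable A]/((@ocitv R).-sigma.-measurable A).
  rewrite RGenOInfty.measurableE.
  apply: smallest_sub; first exact: smallest_sigma_algebra.
  move=> _ /= [x ->]; rewrite -setCitvl.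
  apply: (@measurableC _ (g_sigma_algebraType G)).
  by apply: sub_sigma_algebra; exists x.
apply: (measure_unique G (fun k => `]-oo, k%:R]%classic)) => //.
- move=> _ _ [x ->] [y ->]; exists (Num.min x y).
  by apply/seteqP; split => z /=; rewrite !in_itv/= le_min => /andP.
- by move=> k; exists k%:R.
- apply/seteqP; split => // x _.
  exists (Num.truncn `|x|).+1 => //=; rewrite in_itv/=.
  by rewrite (le_trans (ler_norm _))// ltW// truncnS_gt.
- by move=> _ [x ->].
- move=> k; apply: le_lt_trans fin_mu.
  by apply: le_measureS.
Qed.

Lemma eq_measure_of_cdf_on (R : realType) (I : set R)
    (mu mu' : {measure set R -> \bar R}) :
  I !=set0 -> open I -> is_interval I -> (mu setT < +oo)%E ->
  carried_by mu I -> carried_by mu' I ->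
  (forall x, I x -> mu (`]-oo, x] `&` I) = mu' (`]-oo, x] `&` I)) ->
  Defs.eq_measure mu mu'.
Proof.
move=> I0 oI iI fmu cmu cmu' H.
have mI : measurable I by exact: open_measurable.
have muI : mu I = mu' I.
  apply/eqP; rewrite eq_le; apply/andP; split;
    apply: measure_le_of_cdf => // x Ix; rewrite (H, =^~H) //;
    by apply: le_measureS => //; exact: measurableI.
apply: eq_measure_of_rays => // x.
rewrite -(setTC_carried mI _ cmu)// -(setTC_carried mI _ cmu')//.
have [Ix|nIx] := pselect (I x); first exact: H.
(* For [x] outside the interval [I], the ray up to [x] contains all of [I] or none of it. *)
have [[y Iy xy]|no] := pselect (exists2 y, I y & y <= x).
  rewrite (_ : _ `&` I = I)//; apply/seteqP; split => [z []//|z Iz].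
  split=> //=; rewrite in_itv/= leNgt; apply/negP => xz; apply: nIx.
  by apply: (iI y z) => //; rewrite xy ltW.
rewrite (_ : _ `&` I = set0) ?measure0//; apply/seteqP; split => // z [/=].
by rewrite in_itv/= => zx Iz; apply: no; exists z.
Qed.

(** * Mean of a measure as an integral of its tails *)

Section layer_cake.
Context (R : realType).
Local Notation leb := (@lebesgue_measure R).
Variable eta : {finite_measure set R -> \bar R}.

(** Tonelli's theorem for the indicator of [D], in the form of the uniqueness of the product
    measure. *)
Lemma product_measure_ysection (D : set (R * R)) : measurable D ->
  (\int[eta]_y leb (xsection D y) = \int[leb]_t eta (ysection D t))%E.
Proof.
move=> mD.
rewrite -[LHS]/((eta \x leb)%E D) -[RHS]/((eta \x^ leb)%E D).
by apply: product_measure_unique => // A B mA mB; rewrite /= product_measure2E.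
Qed.

(** The regions between the diagonal and the horizontal axis. Their sections over [y] have as
    lengths the positive and the negative part of [y], while their sections at height [t] are rays;
    Tonelli then turns a mean into integrals of tails. *)
Definition upper_wedge : set (R * R) := [set z | 0 <= z.2 /\ z.2 < z.1].
Definition lower_wedge : set (R * R) := [set z | z.2 < 0 /\ z.1 <= z.2].

Lemma measurable_upper_wedge : measurable upper_wedge.
Proof.
have m1 : measurable_fun setT (fun z : R * R => 0 <= z.2).
  exact: measurable_fun_ler.
have m2 : measurable_fun setT (fun z : R * R => z.2 < z.1).
  exact: measurable_fun_ltr.
have -> : upper_wedge = (setT `&` (fun z => 0 <= z.2) @^-1` [set true]) `&`
    (setT `&` (fun z => z.2 < z.1) @^-1` [set true]).
  by rewrite !setTI; apply/seteqP; split => z [/= ? ?]; split.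
by apply: measurableI; [exact: m1|exact: m2].
Qed.

Lemma measurable_lower_wedge : measurable lower_wedge.
Proof.
have m1 : measurable_fun setT (fun z : R * R => z.2 < 0).
  exact: measurable_fun_ltr.
have m2 : measurable_fun setT (fun z : R * R => z.1 <= z.2).
  exact: measurable_fun_ler.
have -> : lower_wedge = (setT `&` (fun z => z.2 < 0) @^-1` [set true]) `&`
    (setT `&` (fun z => z.1 <= z.2) @^-1` [set true]).
  by rewrite !setTI; apply/seteqP; split => z [/= ? ?]; split.
by apply: measurableI; [exact: m1|exact: m2].
Qed.

Lemma integral_funepos_id : (\int[eta]_y (fun y : R => y%:E)^\+ y =
  \int[leb]_t eta (ysection upper_wedge t))%E.
Proof.
rewrite -product_measure_ysection; last exact: measurable_upper_wedge.
apply: eq_integral => y _; rewrite funeposE.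
have -> : xsection upper_wedge y = `[0, y[%classic.
  by apply/seteqP; split => t; rewrite /xsection/= inE/= in_itv/= => /andP.
rewrite lebesgue_measure_itv/= lte_fin sube0.
by case: ltP => y0; rewrite maxC; [rewrite max_r ?lee_fin// ltW|rewrite max_l].
Qed.

Lemma integral_funeneg_id : (\int[eta]_y (fun y : R => y%:E)^\- y =
  \int[leb]_t eta (ysection lower_wedge t))%E.
Proof.
rewrite -product_measure_ysection; last exact: measurable_lower_wedge.
apply: eq_integral => y _; rewrite funenegE.
have -> : xsection lower_wedge y = `[y, 0[%classic.
  apply/seteqP; split => t; rewrite /xsection/= inE/= in_itv/=.
    by move=> [? ?]; apply/andP.
  by move=> /andP[].
rewrite lebesgue_measure_itv/= lte_fin -EFinB -EFin_max.
by case: ltP => y0; congr EFin; rewrite ?sub0r;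
  [apply/max_idPl; rewrite oppr_ge0 ltW|apply/max_idPr; rewrite oppr_le0].
Qed.

Lemma ysection_upper_wedge (t : R) : ysection upper_wedge t =
  if 0 <= t then `]t, +oo[%classic else set0.
Proof.
apply/seteqP; split => y; rewrite /ysection/= inE/=.
  by move=> [-> ty]; rewrite /= in_itv/= ty.
by case: ifP => //= t0; rewrite in_itv/= andbT.
Qed.

Lemma ysection_lower_wedge (t : R) : ysection lower_wedge t =
  if t < 0 then `]-oo, t]%classic else set0.
Proof.
apply/seteqP; split => y; rewrite /ysection/= inE/=.
  by move=> [-> ty]; rewrite /= in_itv/= ty.
by case: ifP => //= t0; rewrite in_itv/=.
Qed.

End layer_cake.

(** Adding [d] on [[a, b[] to [f] raises its integral by [d * (b - a)], a strict increase because
    that integral is finite. *)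
Lemma lt_integral_of_gap (R : realType) (f g : R -> \bar R) (a b d : R) :
  let leb := @lebesgue_measure R in
  measurable_fun setT f -> measurable_fun setT g ->
  (forall t, 0 <= f t)%E -> (forall t, f t <= g t)%E ->
  a < b -> 0 < d -> (forall t, a <= t < b -> (f t + d%:E <= g t)%E) ->
  (\int[leb]_t f t < +oo -> \int[leb]_t f t < \int[leb]_t g t)%E.
Proof.
move=> leb mf mg f0 fg ab d0 gap finf.
have m1 : measurable_fun setT (fun t : R => (d * \1_`[a, b[ t)%:E).
  apply/measurable_EFinP; apply: measurable_funM => //.
have : (\int[leb]_t (f t + (d * \1_`[a, b[ t)%:E) <= \int[leb]_t g t)%E.
  apply: ge0_le_integral => //.
  - by move=> t _; rewrite adde_ge0// lee_fin mulr_ge0// ltW.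
  - exact: emeasurable_funD.
  - move=> t _; rewrite indicE; have [tab|tab] := boolP (t \in _).
      by rewrite mulr1; apply: gap; move: tab; rewrite inE/= in_itv.
    by rewrite mulr0 adde0.
rewrite ge0_integralD//; last by move=> t _; rewrite lee_fin mulr_ge0// ltW.
have -> : (\int[leb]_t (d * \1_`[a, b[ t)%:E = (d * (b - a))%:E)%E.
  under eq_integral do rewrite EFinM.
  rewrite integralZl//; last exact: integrable_indic_itv.
  by rewrite integral_indic//= setIT lebesgue_measure_itv/= lte_fin ab.
apply: lt_le_trans.
by rewrite lteDl ?lte_fin ?mulr_gt0 ?subr_gt0// ge0_fin_numE// integral_ge0.
Qed.

Lemma measurable_fun_wedge (R : realType) (eta : {finite_measure set R -> \bar R})
    (D : set (R * R)) : measurable D ->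
  measurable_fun setT (fun t => eta (ysection D t)).
Proof. by move=> mD; exact: measurable_fun_ysection. Qed.

Lemma ray_complement (R : realType) (eta : {finite_measure set R -> \bar R})
    (t : R) :
  (eta `]t, +oo[%classic = eta setT - eta `]-oo, t]%classic)%E.
Proof.
have -> : `]t, +oo[%classic = setT `\` `]-oo, t]%classic :> set R.
  by rewrite setTD setCitvl.
by rewrite measureD// ?setTI// ltey_eq fin_num_measure.
Qed.

(** Spreads a strict inequality at one point over an interval to its right, which has positive
    Lebesgue measure. *)
Lemma cdf_right_continuous (R : realType) (eta : {finite_measure set R -> \bar R})
    (x : R) (c : \bar R) : (eta `]-oo, x]%classic < c)%E ->
  exists2 y, x < y & (eta `]-oo, y]%classic < c)%E.
Proof.
move=> xc; apply: contrapT => no.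
pose F (k : nat) : set R := `]-oo, x + k.+1%:R^-1]%classic.
have FI : \bigcap_k F k = `]-oo, x]%classic.
  apply/seteqP; split => [y Fy|y /= + k _] /=; rewrite !in_itv/=.
    apply/ler_addgt0Pr => e e0.
    have := Fy (Num.truncn e^-1) I; rewrite /F/= in_itv/= => /le_trans; apply.
    rewrite lerD2l -[leRHS]invrK lef_pV2 ?posrE ?invr_gt0//.
    by rewrite ltW// truncnS_gt.
  by move=> /le_trans; apply; rewrite lerDl invr_ge0.
have := @nonincreasing_cvg_mu _ _ _ eta F.
rewrite FI => cF.
suff : (c <= eta `]-oo, x]%classic)%E by rewrite leNgt xc.
have {}cF : eta \o F @ \oo --> eta `]-oo, x]%classic.
  apply: cF => //.
  - by rewrite ltey_eq fin_num_measure//; exact: measurable_itv.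
  - by move=> k; exact: measurable_itv.
  - move=> a b ab; apply/subsetPset => y; rewrite /F/= !in_itv/= => /le_trans.
    by apply; rewrite lerD2l lef_pV2 ?posrE// ler_nat ltnS.
rewrite -(cvg_lim _ cF)//; apply: lime_ge.
  by apply/cvg_ex; eexists; exact: cF.
apply: nearW => k; rewrite leNgt; apply/negP => Fk; apply: no.
by exists (x + k.+1%:R^-1) => //; rewrite ltrDl invr_gt0.
Qed.

(** The two inequalities push the difference the same way, so neither can be strict; finiteness of
    the difference excludes the infinite cases. *)
Lemma sub_eq_split (R : realType) (p q p' q' : \bar R) :
  (p' - q' \is a fin_num)%E -> (p - q = p' - q')%E -> (p' <= p)%E ->
  (q <= q')%E -> [/\ p = p', q = q', (p' < +oo)%E & (q < +oo)%E].
Proof.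
case: p p' q q' => [p| |] [p'| |] [q| |] [q'| |] //= _.
rewrite -!EFinB !lee_fin => -[] h1 h2 h3; split; rewrite ?ltry//;
  congr EFin; lra.
Qed.

(** The mean is the integral of the right tails over [t >= 0] minus that of the left tails over
    [t < 0]. Domination orders both integrals so as to favor [theta]; equal means make both
    comparisons equalities. A gap at one point would persist to its right and make one of them
    strict. *)
Lemma eq_measure_of_dominated_cdf (R : realType)
    (eta theta : {finite_measure set R -> \bar R}) :
  theta setT = eta setT ->
  (forall x : R, theta `]-oo, x]%classic <= eta `]-oo, x]%classic)%E ->
  ((\int[eta]_y y%:E)%E \is a fin_num) ->
  (\int[theta]_y y%:E = \int[eta]_y y%:E)%E ->
  Defs.eq_measure eta theta.
Proof.
move=> teT le_cdf fin eqm.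
have mU := @measurable_upper_wedge R; have mL := @measurable_lower_wedge R.
pose leb := @lebesgue_measure R.
pose U (mu : {finite_measure set R -> \bar R}) t :=
  mu (ysection (@upper_wedge R) t).
pose L (mu : {finite_measure set R -> \bar R}) t :=
  mu (ysection (@lower_wedge R) t).
have U0 mu t : (0 <= U mu t)%E by [].
have L0 mu t : (0 <= L mu t)%E by [].
have mUm mu : measurable_fun setT (U mu) by exact: measurable_fun_wedge.
have mLm mu : measurable_fun setT (L mu) by exact: measurable_fun_wedge.
have le_tail t : (eta `]t, +oo[%classic <= theta `]t, +oo[%classic)%E.
  by rewrite !ray_complement teT; exact: leeB.
have leU t : (U eta t <= U theta t)%E.
  by rewrite /U ysection_upper_wedge; case: ifP => _; rewrite ?measure0.
have leL t : (L theta t <= L eta t)%E.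
  by rewrite /L ysection_lower_wedge; case: ifP => _; rewrite ?measure0.
have meanE (mu : {finite_measure set R -> \bar R}) :
    (\int[mu]_y y%:E = \int[leb]_t U mu t - \int[leb]_t L mu t)%E.
  by rewrite integralE integral_funepos_id integral_funeneg_id.
have iU0 (mu : {finite_measure set R -> \bar R}) : (0 <= \int[leb]_t U mu t)%E.
  exact: integral_ge0.
have iL0 (mu : {finite_measure set R -> \bar R}) : (0 <= \int[leb]_t L mu t)%E.
  exact: integral_ge0.
have leiU : (\int[leb]_t U eta t <= \int[leb]_t U theta t)%E.
  by apply: ge0_le_integral => //; exact: mUm.
have leiL : (\int[leb]_t L theta t <= \int[leb]_t L eta t)%E.
  by apply: ge0_le_integral => //; exact: mLm.
have fint : (\int[theta]_y y%:E)%E \is a fin_num by rewrite eqm.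
have [eU eL fU fL] : [/\ (\int[leb]_t U theta t = \int[leb]_t U eta t)%E,
    (\int[leb]_t L theta t = \int[leb]_t L eta t)%E,
    (\int[leb]_t U eta t < +oo)%E & (\int[leb]_t L theta t < +oo)%E].
  by apply: sub_eq_split => //; rewrite -!meanE.
apply: eq_measure_of_rays => [|x]; first by rewrite ltey_eq fin_num_measure.
apply/eqP; rewrite eq_le le_cdf andbT leNgt; apply/negP => xlt.
have [y0 xy0 y0lt] := cdf_right_continuous xlt.
pose c := fine (eta `]-oo, x]%classic) - fine (theta `]-oo, y0]%classic).
have c0 : 0 < c.
  rewrite subr_gt0 fine_lt// ?fin_num_measure//; exact: measurable_itv.
have gap t : x <= t < y0 ->
    (theta `]-oo, t]%classic + c%:E <= eta `]-oo, t]%classic)%E.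
  move=> /andP[xt ty0].
  have h1 : (eta `]-oo, x]%classic <= eta `]-oo, t]%classic)%E.
    by apply: le_measureS => // z; rewrite /= !in_itv/= => /le_trans; apply.
  have h2 : (theta `]-oo, t]%classic <= theta `]-oo, y0]%classic)%E.
    apply: le_measureS => // z; rewrite /= !in_itv/= => /le_trans; apply.
    exact: ltW.
  apply: le_trans h1; apply: (@le_trans _ _ (theta `]-oo, y0]%classic + c%:E)%E).
    exact: leeD2r.
  have fr (mu : {finite_measure set R -> \bar R}) (z : R) :
      mu `]-oo, z]%classic \is a fin_num.
    by rewrite fin_num_measure//; exact: measurable_itv.
  by rewrite /c EFinB !fineK// addeCA subee// adde0.
(* The gap on [[x, y0[] is seen by the upper wedge if [x] is nonnegative; otherwise its part below
   [0] is seen by the lower one. *)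
have [x0|x0] := leP 0 x.
  suff : (\int[leb]_t U eta t < \int[leb]_t U theta t)%E by rewrite eU ltxx.
  apply: (lt_integral_of_gap (a := x) (b := y0) (d := c)) => // t xt.
  have t0 : 0 <= t by move: xt => /andP[xt _]; exact: le_trans xt.
  rewrite /U !ysection_upper_wedge t0 !ray_complement teT.
  have := gap t xt.
  have [a ->] : exists a, theta `]-oo, t]%classic = a%:E.
    exists (fine (theta `]-oo, t]%classic)).
    by rewrite fineK// fin_num_measure//; exact: measurable_itv.
  have [b ->] : exists a, eta `]-oo, t]%classic = a%:E.
    exists (fine (eta `]-oo, t]%classic)).
    by rewrite fineK// fin_num_measure//; exact: measurable_itv.
  rewrite -(@fineK _ (eta setT)) ?fin_num_measure//.
  rewrite -!EFinB -!EFinD !lee_fin; lra.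
suff : (\int[leb]_t L theta t < \int[leb]_t L eta t)%E by rewrite eL ltxx.
pose y1 := Num.min y0 0.
apply: (lt_integral_of_gap (a := x) (b := y1) (d := c)) => //.
  by rewrite lt_min xy0.
move=> t /andP[xt]; rewrite lt_min => /andP[ty0 t0].
by rewrite /L !ysection_lower_wedge t0; apply: gap; rewrite xt.
Qed.

(* The clamp form of the distribution function of [gamma_a^(a+m)] makes the
   distribution functions of two connected parts of equal mass comparable. *)
Lemma eq_measure_of_clamped_cdf (R : realType) (I : set R) (G : R -> \bar R)
    (a a' m : R) (eta theta : {finite_measure set R -> \bar R}) :
  I !=set0 -> open I -> is_interval I ->
  carried_by eta I -> carried_by theta I ->
  eta I = m%:E -> theta I = m%:E ->
  (forall x, I x -> eta (`]-oo, x] `&` I) =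
    mine (maxe (G x - a%:E) 0) m%:E)%E ->
  (forall x, I x -> theta (`]-oo, x] `&` I) =
    mine (maxe (G x - a'%:E) 0) m%:E)%E ->
  ((\int[eta]_y y%:E)%E \is a fin_num) ->
  (\int[theta]_y y%:E = \int[eta]_y y%:E)%E ->
  Defs.eq_measure eta theta.
Proof.
move=> I0 oI iI.
have mI : measurable I by exact: open_measurable.
wlog aa' : a a' eta theta / a <= a'.
  move=> wl ce ct em tm eF tF fin eqm.
  have [aa'|/ltW aa'] := leP a a'; first exact: (wl a a').
  move=> B mB; apply/esym.
  by apply: (wl a' a theta eta) => //; rewrite eqm.
move=> ce ct em tm eF tF fin eqm.
have allT (mu : {finite_measure set R -> \bar R}) :
    carried_by mu I -> mu setT = mu I.
  by move=> cmu; rewrite -(setTC_carried mI _ cmu)// setTI.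
apply: eq_measure_of_dominated_cdf => //; first by rewrite !allT// em.
have rayE (mu : {finite_measure set R -> \bar R}) x : carried_by mu I ->
    mu (`]-oo, x] `&` I) = mu `]-oo, x]%classic.
  by move=> cmu; exact: setTC_carried.
move=> x; have [Ix|nIx] := pselect (I x).
  rewrite -!rayE//.
  rewrite eF// tF// le_min; apply/andP; split; last by rewrite ge_min lexx orbT.
  rewrite ge_min; apply/orP; left; rewrite ge_max !le_max lexx orbT andbT.
  by apply/orP; left; apply: leeB.
have [[y Iy xy]|no] := pselect (exists2 y, I y & y <= x).
  rewrite -!rayE// (_ : `]-oo, x] `&` I = I) ?em ?tm//.
  apply/seteqP; split => [z []//|z Iz].
  split=> //=; rewrite in_itv/= leNgt; apply/negP => xz; apply: nIx.
  by apply: (iI y z) => //; rewrite xy ltW.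
rewrite -!rayE// (_ : `]-oo, x] `&` I = set0) ?measure0//.
apply/seteqP; split => // z [/=].
by rewrite in_itv/= => zx Iz; apply: no; exists z.
Qed.

(** * Finite sums of measures *)

Lemma finite_measure_of d (T : measurableType d) (R : realType)
    (mu : {measure set T -> \bar R}) : (mu setT < +oo)%E ->
  exists eta : {finite_measure set T -> \bar R}, forall B, eta B = mu B.
Proof.
move=> fmu; exists (mfrestr measurableT fmu) => B.
by rewrite -[LHS]/(mu (B `&` setT)) setIT.
Qed.

Lemma measure_trace_sum d (T : measurableType d) (R : realType)
    (mu : {measure set T -> \bar R}) (n : nat) (F : 'I_n -> set T) (B : set T) :
  (forall i, measurable (F i)) -> trivIset setT F ->
  mu (~` \bigcup_i F i) = 0%E -> measurable B ->
  mu B = (\sum_(i < n) mu (B `&` F i))%E.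
Proof.
move=> mF tF F0 mB.
have mU : measurable (\bigcup_i F i).
  by apply: fin_bigcup_measurable => //; exact: finite_finset.
rewrite -[in LHS](setIT B) -(setUv (\bigcup_i F i)) setIUr measureU//.
- rewrite [X in (_ + X)%E](_ : _ = 0%E) ?adde0; last first.
    apply: null_subset F0; [|exact: measurableC|exact: subIsetr].
    by apply: measurableI => //; exact: measurableC.
  rewrite setI_bigcupr measure_fin_bigcup//.
  + rewrite [X in \sum_(i \in X) _](_ : _ = [set` index_enum 'I_n]).
      by rewrite -fsbig_seq// index_enum_uniq.
    by apply/seteqP; split => i //= _; rewrite mem_index_enum.
  + exact: finite_finset.
  + by apply: trivIset_setIl.
  + by move=> i _; exact: measurableI.
- exact: measurableI.
- by apply: measurableI => //; exact: measurableC.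
- by rewrite setIACA setICr setI0.
Qed.

Section sum_of_measures.
Context d (T : measurableType d) (R : realType) (n : nat).
Variables (mu : {measure set T -> \bar R})
  (mu_ : 'I_n -> {measure set T -> \bar R}).
Hypothesis muE : forall B, measurable B -> mu B = (\sum_(i < n) mu_ i B)%E.

Lemma ge0_integral_sum_measures (D : set T) (f : T -> \bar R) :
  measurable D -> (forall x, D x -> 0 <= f x)%E -> measurable_fun D f ->
  (\int[mu]_(x in D) f x = \sum_(i < n) \int[mu_ i]_(x in D) f x)%E.
Proof.
move=> mD f0 mf.
(* [msum] runs over natural numbers: the family is extended by the zero measure. *)
pose m_ (k : nat) : {measure set T -> \bar R} :=
  if insub k is Some i then mu_ i else mzero.
have m_E (i : 'I_n) : m_ i = mu_ i by rewrite /m_ valK.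
rewrite (eq_measure_integral (msum m_ n)).
  by rewrite ge0_integral_measure_sum//; apply: eq_bigr => i _; rewrite m_E.
move=> A mA _; rewrite muE// /msum.
by apply: eq_bigr => i _; rewrite -m_E.
Qed.

Lemma integrable_summand (D : set T) (f : T -> \bar R) i :
  measurable D -> mu.-integrable D f -> (mu_ i).-integrable D f.
Proof.
move=> mD /integrableP[mf fi]; apply/integrableP; split => //.
apply: le_lt_trans fi.
rewrite ge0_integral_sum_measures//; last exact: measurableT_comp.
rewrite (bigD1 i)//= leeDl// sume_ge0// => j _; exact: integral_ge0.
Qed.

Lemma integral_sum_measures (D : set T) (f : T -> \bar R) :
  measurable D -> mu.-integrable D f ->
  (\int[mu]_(x in D) f x = \sum_(i < n) \int[mu_ i]_(x in D) f x)%E.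
Proof.
move=> mD fi; have mf := measurable_int _ fi.
have fii i := integrable_summand i mD fi.
have posE := ge0_integral_sum_measures mD
  (fun x _ => funepos_ge0 f x) (measurable_funepos mf).
have negE := ge0_integral_sum_measures mD
  (fun x _ => funeneg_ge0 f x) (measurable_funeneg mf).
rewrite integralE posE negE.
under [RHS]eq_bigr do rewrite integralE.
rewrite [RHS]big_split/=; congr (_ + _)%E; rewrite sumeN// => i j _ _.
by rewrite fin_num_adde_defl// integrable_neg_fin_num.
Qed.

End sum_of_measures.

(** * Couplings with a finitely supported first marginal *)

Section finite_support.
Context (R : realType) (I : set R) (lambda1 : {measure set R -> \bar R}).
Hypothesis oI : open I.
Hypothesis lambda1_I : carried_by lambda1 I.
Context (n : nat) (J : 'I_n -> R).
Hypothesis bijJ : set_bij [set: 'I_n] (support_in I lambda1) J.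

Lemma atomsE : support_in I lambda1 = [set J i | i in [set: 'I_n]].
Proof.
by case: bijJ => funJ _ surjJ; apply/seteqP; split => // _ [i _ <-];
  exact: funJ.
Qed.

Lemma atoms_inj : injective J.
Proof. by case: bijJ => _ inj _ i j; apply: inj; rewrite inE. Qed.

Lemma atoms_in i : I (J i).
Proof. by have [] : support_in I lambda1 (J i) by rewrite atomsE; exists i. Qed.

Lemma closed_atoms (P : set 'I_n) : closed [set J i | i in P].
Proof.
have /accessible_finite_set_closed := hausdorff_accessible (@Rhausdorff R).
by apply; exact/finite_image/finite_finset.
Qed.

(** A point of [I] off the support has a null open neighborhood, so the complement is locally
    null. *)
Lemma null_off_atoms : lambda1 (~` [set J i | i in [set: 'I_n]]) = 0%E.
Proof.
have mI : measurable I by exact: open_measurable.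
have mA := closed_measurable (@closed_atoms [set: 'I_n]).
have mCA := measurableC mA.
rewrite -(setTC_carried mI mCA lambda1_I).
apply: null_of_locally_null; first exact: measurableI.
move=> y [ny Iy]; apply: contrapT => noU; apply: ny; rewrite -atomsE.
split=> // U oU Uy; rewrite lt0e measure_ge0 andbT; apply/eqP => U0.
by apply: noU; exists U.
Qed.

Lemma trivIset_atoms : trivIset [set: 'I_n] (fun i => [set J i]).
Proof. by move=> i j _ _ [x [/= -> /atoms_inj]]. Qed.

Lemma bigcup_atoms :
  \bigcup_(i in [set: 'I_n]) [set J i] = [set J i | i in [set: 'I_n]].
Proof. exact: bigcup_imset1. Qed.

Lemma atom_sum (B : set R) : measurable B ->
  lambda1 B = (\sum_(i < n) lambda1 (B `&` [set J i]))%E.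
Proof.
move=> mB; apply: measure_trace_sum => //; first exact: trivIset_atoms.
by rewrite bigcup_atoms null_off_atoms.
Qed.

(** The complement of the other atoms is an open neighborhood of [J i], and its whole mass sits at
    [J i]. *)
Lemma atom_gt0 i : (0 < lambda1 [set J i])%E.
Proof.
have [_] : support_in I lambda1 (J i) by rewrite atomsE; exists i.
pose U := ~` [set J k | k in [set k | k != i]].
move=> /(_ U); have oU : open U by exact/closed_openC/closed_atoms.
have UJi : U (J i) by move=> [k /= /eqP ki /atoms_inj].
move=> /(_ oU UJi); rewrite atom_sum; last exact: open_measurable.
rewrite (bigD1 i)//= big1 ?adde0.
  by rewrite (_ : _ `&` _ = [set J i])//; apply/seteqP; split => [x []|x /= ->].
move=> k ki; rewrite (_ : _ `&` _ = set0) ?measure0//.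
by apply/seteqP; split => // x [/= Ux xk]; apply: Ux; exists k.
Qed.

End finite_support.

Section fibers.
Context (R : realType) (n : nat) (J : 'I_n -> R).

(** The sum of the products of the Dirac masses at [J i] with [eta i], evaluated through sections;
    [fibered_product] translates back to products. *)
Definition fibered (nu : {measure set (R * R) -> \bar R})
    (eta : 'I_n -> {finite_measure set R -> \bar R}) :=
  forall B : set (R * R), measurable B ->
    nu B = (\sum_(i < n) eta i (xsection B (J i)))%E.

Variables (nu : {measure set (R * R) -> \bar R})
  (eta : 'I_n -> {finite_measure set R -> \bar R}).
Hypothesis nuE : fibered nu eta.

Lemma measurable_pair (x : R) : measurable_fun [set: R] (pair x : R -> R * R).
Proof. exact: pair1_measurable. Qed.

Let line_measure i : {measure set (R * R) -> \bar R} :=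
  measure_function_pushforward__canonical__measure_function_Measure (eta i)
    (measurable_pair (J i)).

Let line_measureE (B : set (R * R)) : measurable B ->
  nu B = (\sum_(i < n) line_measure i B)%E.
Proof.
move=> mB; rewrite nuE//; apply: eq_bigr => i _.
by rewrite /line_measure /= /pushforward xsectionE.
Qed.

Lemma ge0_integral_fibered (D : set (R * R)) (f : R * R -> \bar R) :
  measurable D -> (forall z, D z -> 0 <= f z)%E -> measurable_fun D f ->
  (\int[nu]_(z in D) f z =
   \sum_(i < n) \int[eta i]_(y in xsection D (J i)) f (J i, y))%E.
Proof.
move=> mD f0 mf; rewrite (ge0_integral_sum_measures line_measureE)//.
apply: eq_bigr => i _; rewrite (ge0_integral_pushforward (measurable_pair _))//.
  by rewrite xsectionE.
by move=> z; rewrite inE; exact: f0.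
Qed.

Lemma integrable_fibered (D : set (R * R)) (f : R * R -> \bar R) :
  measurable D -> measurable_fun D f ->
  (forall i, (eta i).-integrable (xsection D (J i)) (fun y => f (J i, y))) ->
  nu.-integrable D f.
Proof.
move=> mD mf fi; apply/integrableP; split => //.
rewrite ge0_integral_fibered//; last exact: measurableT_comp.
by apply/lte_sum_pinfty => i _; have /integrableP[] := fi i.
Qed.

Lemma integrable_fiber (D : set (R * R)) (f : R * R -> \bar R) i :
  measurable D -> nu.-integrable D f ->
  (eta i).-integrable (xsection D (J i)) (fun y => f (J i, y)).
Proof.
move=> mD fi; have mf := measurable_int _ fi.
apply/integrableP; split.
  apply: (@measurable_comp _ _ _ _ _ _ D) => //.
    by move=> _ [y + <-]; rewrite xsectionE.
  exact: measurable_funTS (measurable_pair _).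
move/integrableP : fi => [_]; apply: le_lt_trans.
rewrite ge0_integral_fibered//; last exact: measurableT_comp.
rewrite (bigD1 i)//= leeDl// sume_ge0// => j _; exact: integral_ge0.
Qed.

Lemma integral_fibered (D : set (R * R)) (f : R * R -> \bar R) :
  measurable D -> nu.-integrable D f ->
  (\int[nu]_(z in D) f z =
   \sum_(i < n) \int[eta i]_(y in xsection D (J i)) f (J i, y))%E.
Proof.
move=> mD fi; have mf := measurable_int _ fi.
have posE := ge0_integral_fibered mD
  (fun x _ => funepos_ge0 f x) (measurable_funepos mf).
have negE := ge0_integral_fibered mD
  (fun x _ => funeneg_ge0 f x) (measurable_funeneg mf).
rewrite integralE posE negE.
under [RHS]eq_bigr do rewrite integralE.
have fin i : (\int[eta i]_(y in xsection D (J i))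
    (fun y => f (J i, y))^\- y)%E \is a fin_num.
  apply: integrable_neg_fin_num; last exact: integrable_fiber.
  exact: measurable_xsection.
rewrite [RHS]big_split/=; congr (_ + _)%E.
  apply: eq_bigr => i _; apply: eq_integral => y _; by rewrite !funeposE.
rewrite sumeN; last first.
  by move=> i j _ _; rewrite fin_num_adde_defl//; exact: fin.
by congr (- _)%E; apply: eq_bigr => i _; apply: eq_integral => y _;
  rewrite !funenegE.
Qed.

End fibers.

(** A martingale coupling read off its fibers. The last clause is the martingale property tested on
    the atom [J i]: the barycenter of the fiber is [J i]. *)
Definition transport_family (R : realType) (I : set R)
    (lambda1 lambda2 : {measure set R -> \bar R}) (n : nat) (J : 'I_n -> R)
    (eta : 'I_n -> {finite_measure set R -> \bar R}) : Prop :=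
  [/\ forall i, carried_by (eta i) I,
      forall i, eta i setT = lambda1 [set J i],
      forall B : set R, measurable B -> lambda2 B = (\sum_(i < n) eta i B)%E &
      forall i, (\int[eta i]_y y%:E = lambda1 [set J i] * (J i)%:E)%E].

Lemma measurable_fst_preimage (R : realType) (B : set R) : measurable B ->
  measurable (fst @^-1` B : set (R * R)).
Proof. by move=> mB; rewrite -[X in measurable X]setTI; exact: measurable_fst. Qed.

Lemma measurable_snd_preimage (R : realType) (B : set R) : measurable B ->
  measurable (snd @^-1` B : set (R * R)).
Proof. by move=> mB; rewrite -[X in measurable X]setTI; exact: measurable_snd. Qed.

Lemma xsection_fst_preimage (R : realType) (B : set R) (x : R) :
  xsection (fst @^-1` B : set (R * R)) x = if x \in B then setT else set0.
Proof.
apply/seteqP; split => y; rewrite /xsection /= inE /=.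
  by move=> /mem_set ->.
by case: ifP => // /set_mem.
Qed.

Lemma xsection_snd_preimage (R : realType) (B : set R) (x : R) :
  xsection (snd @^-1` B : set (R * R)) x = B.
Proof. by apply/seteqP; split => y; rewrite /xsection /= inE. Qed.

Section families.
Context (R : realType) (I : set R) (lambda1 lambda2 : probability R R).
Hypothesis oI : open I.
Hypothesis lambda1_I : carried_by lambda1 I.
Context (n : nat) (J : 'I_n -> R).
Hypothesis bijJ : set_bij [set: 'I_n] (support_in I lambda1) J.

Let mI : measurable I. Proof. exact: open_measurable. Qed.

(** The fiber over [J i] is the second marginal of the restriction of [nu] to the vertical line
    through [J i]. These lines carry [nu] because the first marginal lives on the atoms. *)
Lemma fibers_of_coupling (nu : {measure set (R * R) -> \bar R}) :
  martingale_coupling I lambda1 lambda2 nu ->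
  exists eta, transport_family I lambda1 lambda2 J eta /\ fibered J nu eta.
Proof.
move=> [[nu1 nuI] marg1 marg2 [int2 int1 _ condE]].
pose F i : set (R * R) := fst @^-1` [set J i].
have mF i : measurable (F i) by exact: measurable_fst_preimage.
have fibers i : {eta : {finite_measure set R -> \bar R} |
    forall B, eta B = nu (snd @^-1` B `&` F i)}.
  apply: cid.
  pose fib : {measure set R -> \bar R} :=
    measure_function_pushforward__canonical__measure_function_Measure
      (mrestr nu (mF i)) (@measurable_snd _ _ R R).
  have fibE B : fib B = nu (snd @^-1` B `&` F i) by [].
  have : (fib setT < +oo)%E.
    rewrite fibE (@le_lt_trans _ _ 1%E) ?ltry// -nu1 le_measureS//.
    by apply: measurableI => //; exact: measurable_snd_preimage.
  by move=> /finite_measure_of[e eE]; exists e => B; rewrite eE.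
pose eta i := sval (fibers i).
have etaE i B : eta i B = nu (snd @^-1` B `&` F i) by exact: svalP (fibers i) B.
have nuE : fibered J nu eta.
  move=> B mB; rewrite (@measure_trace_sum _ _ _ _ _ F)//.
  - apply: eq_bigr => i _; rewrite etaE; congr (nu _).
    apply/seteqP; split => -[x y] [/= Bxy]; rewrite /F/= => xi; subst x.
      by split => //=; rewrite /xsection/= inE.
    by split => //; move: Bxy; rewrite /xsection/= inE.
  - move=> i j _ _ [z [Fi Fj]]; apply: (atoms_inj bijJ).
    exact: (etrans (esym Fi) Fj).
  - rewrite (_ : ~` _ = fst @^-1` (~` [set J i | i in [set: 'I_n]])).
      rewrite marg1 ?(null_off_atoms oI lambda1_I bijJ)//.
      by apply: measurableC; apply: (@closed_measurable R); exact: closed_atoms.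
    apply/seteqP; split => z nz.
      by move=> [i _ zi]; apply: nz; exists i => //; rewrite /F/= zi.
    by move=> [i _ zi]; apply: nz; exists i => //; rewrite -zi.
exists eta; split => //; split.
- move=> i; suff : eta i (~` I) = 0%E by []; rewrite etaE.
  apply: null_subset nuI.
  + apply: measurableI => //; apply: measurable_snd_preimage.
    exact: measurableC.
  + by apply: measurableC; exact: measurableX.
  + by move=> -[x y] [/= nIy _] [].
- by move=> i; rewrite etaE preimage_setT setTI marg1.
- move=> B mB; rewrite -marg2// nuE; last exact: measurable_snd_preimage.
  by apply: eq_bigr => i _; rewrite xsection_snd_preimage.
(* The line [F i] is an event of the sigma-algebra of [fst], and [fst] is constant on it. *)
- move=> i; have GF : g_sigma_algebra_preimage (fst : R * R -> R) (F i).
    by exists [set J i] => //; rewrite setTI.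
  have := condE _ GF.
  rewrite (eq_integral (fun=> (J i)%:E)); last first.
    by move=> z /set_mem Fz; congr EFin.
  rewrite integral_cst// (integral_fibered nuE)//; last first.
    by apply: integrableS int2.
  rewrite (bigD1 i)//= [X in (_ + X)%E]big1 ?adde0; last first.
    move=> j ji; rewrite xsection_fst_preimage ifF ?integral_set0//.
    by apply/negbTE; rewrite notin_setE => /= /(atoms_inj bijJ)/eqP; apply/negP.
  rewrite xsection_fst_preimage ifT ?inE// => <-.
  by rewrite muleC marg1.
Qed.

Lemma coupling_of_fibers (nu : {measure set (R * R) -> \bar R})
    (eta : 'I_n -> {finite_measure set R -> \bar R}) :
  finite_mean lambda2 ->
  transport_family I lambda1 lambda2 J eta -> fibered J nu eta ->
  martingale_coupling I lambda1 lambda2 nu.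
Proof.
move=> mean2 [etaI mass marg mean] nuE.
have msum : forall B, measurable B ->
    lambda2 B = (\sum_(i < n) (eta i : {measure set R -> \bar R}) B)%E by [].
have int_eta i : (eta i).-integrable setT (fun y : R => y%:E).
  exact: (integrable_summand msum) mean2.
have mfst : measurable_fun [set: R * R] (EFin \o (fst : R * R -> R)).
  by apply/measurable_EFinP; exact: measurable_fst.
have msnd : measurable_fun [set: R * R] (EFin \o (snd : R * R -> R)).
  by apply/measurable_EFinP; exact: measurable_snd.
have xT (x : R) : xsection [set: R * R] x = setT.
  by apply/seteqP; split => y //= _; rewrite /xsection/= inE.
have int1 : nu.-integrable setT (EFin \o (fst : R * R -> R)).
  apply: (integrable_fibered nuE) => // i; rewrite xT /=.
  exact: finite_measure_integrable_cst.
have int2 : nu.-integrable setT (EFin \o (snd : R * R -> R)).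
  by apply: (integrable_fibered nuE) => // i; rewrite xT /=; exact: int_eta.
split.
- split.
    rewrite nuE// -(probability_setT lambda2) marg//.
    by apply: eq_bigr => i _; rewrite xT.
  rewrite /carried_by nuE; last by apply: measurableC; exact: measurableX.
  apply: big1 => i _; rewrite (_ : xsection _ _ = ~` I); first exact: etaI.
  have IJ := atoms_in bijJ i.
  apply/seteqP; split => y; rewrite /xsection/= inE/=.
    by move=> nz Iy; apply: nz; split.
  by move=> nIy [].
- move=> B mB; rewrite nuE; last exact: measurable_fst_preimage.
  rewrite (atom_sum oI lambda1_I bijJ)//; apply: eq_bigr => i _.
  rewrite xsection_fst_preimage; case: ifPn => [/set_mem BJ|].
    apply: (etrans (mass i)); congr (lambda1 _).
    by apply/seteqP; split => [x /= ->//|x []].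
  rewrite notin_setE measure0 => nB.
  rewrite (_ : _ `&` _ = set0) ?measure0//.
  by apply/seteqP; split => // x [Bx /= xJ]; apply: nB; rewrite -xJ.
- move=> B mB; rewrite nuE; last exact: measurable_snd_preimage.
  by rewrite marg//; apply: eq_bigr => i _; rewrite xsection_snd_preimage.
- split => //.
    by move=> B mB; exists B => //; rewrite setTI.
  (* An event of this sigma-algebra contains each vertical line or misses it, so the martingale
     identity reduces to the barycenters of the fibers. *)
  move=> _ [B mB <-]; rewrite setTI.
  have mfB := measurable_fst_preimage mB.
  rewrite (integral_fibered nuE)//; last exact: integrableS int1.
  rewrite (integral_fibered nuE)//; last exact: integrableS int2.
  apply: eq_bigr => i _; rewrite xsection_fst_preimage; case: ifP => _ /=.
    rewrite integral_cst// mean muleC; congr (_ * _)%E; exact: mass.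
  by rewrite !integral_set0.
Qed.

Lemma fibered_measure_exists (eta : 'I_n -> {finite_measure set R -> \bar R}) :
  exists nu : {measure set (R * R) -> \bar R}, fibered J nu eta.
Proof.
pose m_ (k : nat) : {measure set (R * R) -> \bar R} :=
  if insub k is Some i then
    measure_function_pushforward__canonical__measure_function_Measure (eta i)
      (measurable_pair (J i))
  else mzero.
exists (msum m_ n) => B mB; apply: eq_bigr => i _.
by rewrite /m_ valK xsectionE.
Qed.

End families.

Lemma fibered_product (R : realType) (n : nat) (J : 'I_n -> R)
    (eta : 'I_n -> {finite_measure set R -> \bar R})
    (nu : {measure set (R * R) -> \bar R}) :
  fibered J nu eta <->
  forall B : set (R * R), measurable B ->
    nu B = (\sum_(i < n) (\d_(J i) \x eta i) B)%E.
Proof.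
have dE (i : 'I_n) B : measurable B ->
    ((\d_(J i) \x eta i) B = eta i (xsection B (J i)))%E.
  move=> mB; rewrite /product_measure1 integral_dirac//.
    by rewrite diracT mul1e.
  exact: measurable_fun_xsection.
by split => nuE B mB; rewrite nuE//; apply: eq_bigr => i _; rewrite dE.
Qed.

(** * Convex hulls of supports *)

Section inner_hull.
Context (R : realType).
Implicit Types eta : {finite_measure set R -> \bar R}.

(** The open interval between the ends of the support, empty for a Dirac mass. Tail masses avoid any
    discussion of infinite ends. *)
Definition inner_hull eta : set R :=
  [set y | (0 < eta `]-oo, y[%classic)%E /\ (0 < eta `]y, +oo[%classic)%E].

(** Adds to the open hull those ends that are atoms. This is just enough to carry [eta]. *)
Definition outer_hull eta : set R :=
  [set y | (0 < eta `]-oo, y]%classic)%E /\ (0 < eta `[y, +oo[%classic)%E].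

Lemma inner_hull_itv eta : is_interval (inner_hull eta).
Proof.
move=> x y [x1 _] [_ y2] z /andP[xz zy]; split.
  apply: lt_le_trans x1 _; apply: le_measureS => // t /=; rewrite !in_itv/=.
  by move=> tx; exact: lt_le_trans tx xz.
apply: lt_le_trans y2 _; apply: le_measureS => // t /=; rewrite !in_itv/= !andbT.
by move=> yt; exact: le_lt_trans zy yt.
Qed.

Lemma measurable_inner_hull eta : measurable (inner_hull eta).
Proof. by apply: (@is_interval_measurable R); exact: inner_hull_itv. Qed.

Lemma outer_hull_itv eta : is_interval (outer_hull eta).
Proof.
move=> x y [x1 _] [_ y2] z /andP[xz zy]; split.
  apply: lt_le_trans x1 _; apply: le_measureS => // t /=; rewrite !in_itv/=.
  by move=> tx; exact: le_trans tx xz.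
apply: lt_le_trans y2 _; apply: le_measureS => // t /=; rewrite !in_itv/= !andbT.
by move=> yt; exact: le_trans zy yt.
Qed.

Lemma measurable_outer_hull eta : measurable (outer_hull eta).
Proof. by apply: (@is_interval_measurable R); exact: outer_hull_itv. Qed.

Lemma outer_hull_between eta x y z : outer_hull eta x -> outer_hull eta z ->
  x < y < z -> inner_hull eta y.
Proof.
move=> [x1 _] [_ z2] /andP[xy yz]; split.
  apply: lt_le_trans x1 _; apply: le_measureS => // t /=; rewrite !in_itv/=.
  by move=> tx; exact: le_lt_trans tx xy.
apply: lt_le_trans z2 _; apply: le_measureS => // t /=; rewrite !in_itv/= !andbT.
by move=> zt; exact: lt_le_trans yz zt.
Qed.

(** This lower set need not have a greatest element, so its mass is not directly a tail mass. A
    support point [y] inside it is impossible: either a larger element makes a whole neighborhood of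
    [y] null, or [y] is the greatest element and the set lies in a null ray. *)
Lemma null_left_tail eta : eta [set y | eta `]-oo, y]%classic = 0%E] = 0%E.
Proof.
set D := [set y | _].
have lowD x y : x <= y -> D y -> D x.
  move=> xy Dy; apply: null_subset Dy => // t /=; rewrite !in_itv/=.
  by move=> tx; exact: le_trans tx xy.
have mD : measurable D.
  apply: (@is_interval_measurable R) => x y Dx Dy z /andP[_ zy].
  exact: lowD Dy.
apply/eqP; apply: contraT => D0.
have [y Dy posy] := point_of_non_null mD D0.
have [[z yz Dz]|no] := pselect (exists2 z, y < z & D z).
  have := posy `]-oo, z[%classic (interval_open _ _).
  rewrite /= in_itv/= => /(_ isT isT yz).
  rewrite (null_subset _ _ _ Dz) ?ltxx// => t /=; rewrite !in_itv/=.
  exact: ltW.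
move: D0; rewrite (null_subset _ _ _ Dy) ?eqxx// => t Dt /=; rewrite in_itv/=.
by rewrite leNgt; apply/negP => yt; apply: no; exists t.
Qed.

Lemma null_right_tail eta : eta [set y | eta `[y, +oo[%classic = 0%E] = 0%E.
Proof.
set D := [set y | _].
have uppD x y : x <= y -> D x -> D y.
  move=> xy Dx; apply: null_subset Dx => // t /=; rewrite !in_itv/= !andbT.
  exact: le_trans xy.
have mD : measurable D.
  apply: (@is_interval_measurable R) => x y Dx Dy z /andP[xz _].
  exact: uppD Dx.
apply/eqP; apply: contraT => D0.
have [y Dy posy] := point_of_non_null mD D0.
have [[z zy Dz]|no] := pselect (exists2 z, z < y & D z).
  have := posy `]z, +oo[%classic (interval_open _ _).
  rewrite /= in_itv/= andbT => /(_ isT isT zy).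
  rewrite (null_subset _ _ _ Dz) ?ltxx// => t /=; rewrite !in_itv/= !andbT.
  exact: ltW.
move: D0; rewrite (null_subset _ _ _ Dy) ?eqxx// => t Dt /=; rewrite in_itv/=.
by rewrite andbT leNgt; apply/negP => ty; apply: no; exists t.
Qed.

Lemma null_off_outer_hull eta : eta (~` outer_hull eta) = 0%E.
Proof.
apply: measure_negligible; first by apply: measurableC; exact: measurable_outer_hull.
have mL : measurable [set y | eta `]-oo, y]%classic = 0%E].
  apply: (@is_interval_measurable R) => x y /= Dx Dy z /andP[_ zy].
  apply: null_subset Dy => // t /=; rewrite !in_itv/= => tz.
  exact: le_trans zy.
have mU : measurable [set y | eta `[y, +oo[%classic = 0%E].
  apply: (@is_interval_measurable R) => x y /= Dx Dy z /andP[xz _].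
  apply: null_subset Dx => // t /=; rewrite !in_itv/= !andbT.
  exact: le_trans xz.
apply: (@negligibleS _ _ _ _ ([set y | eta `]-oo, y]%classic = 0%E] `|`
   [set y | eta `[y, +oo[%classic = 0%E])).
  move=> y ny; apply: contrapT => /not_orP[/= n1 n2]; apply: ny.
  by split; rewrite lt0e measure_ge0 andbT; apply/eqP.
by apply: negligibleU; apply/negligibleP => //;
  [exact: null_left_tail|exact: null_right_tail].
Qed.

(** Turns tail masses into actual points of any chosen carrier; for a curtain coupling the carrier
    is a section of [Gamma]. *)
Lemma inner_hull_carrier eta (G : set R) : measurable G -> eta (~` G) = 0%E ->
  forall y, inner_hull eta y ->
  exists u v, [/\ G u, G v, u < y & y < v].
Proof.
move=> mG G0 y [y1 y2].
have ex (B : set R) : measurable B -> (0 < eta B)%E -> exists2 u, G u & B u.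
  move=> mB B0; apply: contrapT => no; move: B0.
  rewrite (@null_subset _ _ _ eta B (~` G)) ?ltxx//; first exact: measurableC.
  by move=> u Bu Gu; apply: no; exists u.
have [u Gu] := ex _ (measurable_itv _) y1; rewrite /= in_itv/= => uy.
have [v Gv] := ex _ (measurable_itv _) y2; rewrite /= in_itv/= andbT => yv.
by exists u, v.
Qed.

End inner_hull.

Definition nested (R : realType) (n : nat)
    (eta : 'I_n -> {finite_measure set R -> \bar R}) : Prop :=
  forall i j : 'I_n, (i < j)%N -> eta j (inner_hull (eta i)) = 0%E.

(** Produces the enumeration of the atoms, by rank for curtain couplings and by the values of [g]
    for maximizers. *)
Lemma sorted_bijection (n : nat) (leI : rel 'I_n) :
  total leI -> transitive leI ->
  exists s : 'I_n -> 'I_n,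
    bijective s /\ forall i j : 'I_n, (i <= j)%N -> leI (s i) (s j).
Proof.
move=> tot trans; pose l := sort leI (enum 'I_n).
have sz : size l = n by rewrite size_sort size_enum_ord.
pose s (i : 'I_n) := nth i l i.
have sinj : injective s.
  move=> i j; rewrite /s (set_nth_default i)//; last by rewrite sz.
  move=> /eqP; rewrite nth_uniq ?sz//; last by rewrite sort_uniq enum_uniq.
  by move=> /eqP/val_inj.
exists s; split; first exact: injF_bij.
move=> i j ij; rewrite /s (set_nth_default i j) ?sz//.
apply: sorted_leq_nth => //; rewrite ?inE ?sz//.
- by move=> x; have := tot x x; rewrite orbb.
- exact: sort_sorted.
Qed.

(** * Curtain couplings *)

Lemma null_fin_bigcup d (T : measurableType d) (R : realType)
    (mu : {measure set T -> \bar R}) (n : nat) (P : set 'I_n)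
    (F : 'I_n -> set T) : (forall k, P k -> measurable (F k)) ->
  (forall k, P k -> mu (F k) = 0%E) -> mu (\bigcup_(k in P) F k) = 0%E.
Proof.
move=> mF F0; apply: measure_negligible.
  by apply: fin_bigcup_measurable => //; exact: finite_finset.
pose G (m : nat) : set T :=
  if insub m is Some k then (if `[< P k >] then F k else set0) else set0.
apply: (@negligibleS _ _ _ _ (\bigcup_m G m)).
  by move=> x [k Pk Fx]; exists k => //; rewrite /G valK asboolT.
apply: negligible_bigcup => m; rewrite /G.
case: insubP => [k _ _|_]; last exact: negligible_set0.
case: asboolP => Pk; last exact: negligible_set0.
by apply/negligibleP; [exact: mF|exact: F0].
Qed.

(** Nestedness only says that earlier hulls are null; here they are removed outright. The curtain
    property and the equality case of the duality need this pointwise form. *)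
Definition nested_carrier (R : realType) (n : nat)
    (eta : 'I_n -> {finite_measure set R -> \bar R}) (i : 'I_n) : set R :=
  outer_hull (eta i) `\`
  \bigcup_(k in [set k : 'I_n | (k < i)%N]) inner_hull (eta k).

Lemma measurable_nested_carrier (R : realType) (n : nat)
    (eta : 'I_n -> {finite_measure set R -> \bar R}) (i : 'I_n) :
  measurable (nested_carrier eta i).
Proof.
apply: measurableD; first exact: measurable_outer_hull.
apply: fin_bigcup_measurable => [|k _]; first exact: finite_finset.
exact: measurable_inner_hull.
Qed.

Lemma null_off_nested_carrier (R : realType) (n : nat)
    (eta : 'I_n -> {finite_measure set R -> \bar R}) (i : 'I_n) :
  nested eta -> eta i (~` nested_carrier eta i) = 0%E.
Proof.
move=> nest; have mC := measurable_nested_carrier eta i.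
apply: measure_negligible; first exact: measurableC.
rewrite /nested_carrier setCD; apply: negligibleU.
  apply/negligibleP; last exact: null_off_outer_hull.
  by apply: measurableC; exact: measurable_outer_hull.
apply/negligibleP.
  apply: fin_bigcup_measurable => [|k _]; first exact: finite_finset.
  exact: measurable_inner_hull.
apply: null_fin_bigcup => k ki; first exact: measurable_inner_hull.
exact: nest.
Qed.

Section curtain.
Context (R : realType) (I : set R) (lambda1 lambda2 : probability R R).
Hypothesis oI : open I.
Hypothesis lambda1_I : carried_by lambda1 I.
Context (n : nat).
Implicit Types (J : 'I_n -> R) (nu : {measure set (R * R) -> \bar R})
  (eta : 'I_n -> {finite_measure set R -> \bar R}).

Definition nested_coupling J eta nu : Prop :=
  [/\ set_bij [set: 'I_n] (support_in I lambda1) J,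
      transport_family I lambda1 lambda2 J eta, fibered J nu eta & nested eta].

Lemma set_bij_comp_perm J (s : 'I_n -> 'I_n) : bijective s ->
  set_bij [set: 'I_n] (support_in I lambda1) J ->
  set_bij [set: 'I_n] (support_in I lambda1) (J \o s).
Proof.
move=> [t st ts] bijJ; have AE := atomsE bijJ; have injJ := atoms_inj bijJ.
split.
- by move=> i _; rewrite AE; exists (s i).
- by move=> i j _ _ /injJ/(can_inj st).
- by rewrite AE => _ [i _ <-]; exists (t i) => //=; rewrite ts.
Qed.

Lemma transport_family_perm J eta (s : 'I_n -> 'I_n) : bijective s ->
  transport_family I lambda1 lambda2 J eta ->
  transport_family I lambda1 lambda2 (J \o s) (eta \o s).
Proof.
move=> bs [h1 h2 h3 h4]; split => // [i|i|B mB|i]; [exact: h1|exact: h2| |exact: h4].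
by rewrite h3// (reindex s)//; exact: onW_bij.
Qed.

Lemma fibered_perm J eta nu (s : 'I_n -> 'I_n) : bijective s ->
  fibered J nu eta -> fibered (J \o s) nu (eta \o s).
Proof.
by move=> bs h B mB; rewrite h// (reindex s)//; exact: onW_bij.
Qed.

Lemma nested_of_curtain J0 nu :
  set_bij [set: 'I_n] (support_in I lambda1) J0 ->
  curtain_martingale_coupling I lambda1 lambda2 nu ->
  exists J eta, nested_coupling J eta nu.
Proof.
move=> bij0 [mart [Gamma [mG _ G1 curt]]].
have [eta [fam nuE]] := fibers_of_coupling oI lambda1_I bij0 mart.
have [[nu1 _] _ _ _] := mart.
pose G i := xsection Gamma (J0 i).
have mGi i : measurable (G i) by exact: measurable_xsection.
have G0 i : eta i (~` G i) = 0%E.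
  have : nu (~` Gamma) = 0%E.
    have fT : (nu setT < +oo)%E by rewrite nu1 ltry.
    have d0 : (nu setT - nu Gamma = 0)%E by rewrite nu1 G1 subee.
    rewrite -setTD measureD//.
    by rewrite setTI; exact: d0.
  rewrite nuE; last exact: measurableC.
  move=> s0; apply/eqP; rewrite eq_le measure_ge0 andbT -s0 (bigD1 i)//=.
  rewrite (_ : xsection (~` Gamma) (J0 i) = ~` G i) ?leeDl ?sume_ge0//.
  by apply/seteqP; split => y; rewrite /G/xsection/= !inE.
pose straddles i j := exists y u v,
  [/\ G i y, G j u, G j v & u < y < v].
(* Two fibers straddling each other form exactly the six-point configuration that [curtain_set]
   forbids. *)
have asym i j : i != j -> straddles i j -> ~ straddles j i.
  move=> ij [y [y1' [y2' [Gy G1' G2' h]]]] [y' [y1 [y2 [Gy' G1_ G2_ h']]]].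
  apply: (curt (J0 i) y y1 y2 (J0 j) y' y1' y2') => //.
    by move=> /(atoms_inj bij0)/eqP; apply/negP.
  move: Gy Gy' G1' G2' G1_ G2_; rewrite /G /xsection /= !inE => *.
  by move=> z /=; do 5 ?[case]; move=> ->.
(* If [j] straddles a point [w] of [G i] by [a] and [b], then [a] and [b] enclose everything between
   points of [G i]: were [y <= a], then [u < a < w] would make [i] straddle [j]; likewise for
   [b]. *)
have hull_mono i j y u v : i != j -> straddles i j -> G i u -> G i v ->
    u < y < v -> exists u' v', [/\ G j u', G j v' & u' < y < v'].
  move=> ij sij Gu Gv /andP[uy yv].
  have nji := asym _ _ ij sij.
  have [w [a [b [Gw Ga Gb /andP[aw wb]]]]] := sij.
  exists a, b; split => //; apply/andP; split; rewrite ltNge; apply/negP => le.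
    apply: nji; exists a, u, w; split => //; apply/andP; split => //.
    exact: lt_le_trans uy le.
  apply: nji; exists b, w, v; split => //; apply/andP; split => //.
  exact: le_lt_trans le yv.
pose prec i j := (i != j) && `[< straddles i j >].
have precP i j : reflect (i != j /\ straddles i j) (prec i j).
  by apply: (iffP andP) => -[-> /asboolP].
have prec_trans i j k : prec i j -> prec j k -> prec i k.
  move=> /precP[ij sij] /precP[jk [y [u [v [Gy Gu Gv uyv]]]]].
  have sjk : straddles j k by exists y, u, v.
  have [w [a [b [Gw Ga Gb awb]]]] := sij.
  have [a' [b' [Ga' Gb' wab]]] := hull_mono _ _ _ _ _ jk sjk Ga Gb awb.
  apply/precP; split; last by exists w, a', b'.
  apply/eqP => ik; subst k; exact: asym sij sjk.
(* Counting predecessors linearizes the strict partial order: transitivity makes predecessor sets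
   grow, and irreflexivity makes them grow strictly. *)
pose rank i := #|[pred j | prec j i]|%N.
have rank_lt i j : prec i j -> (rank i < rank j)%N.
  move=> pij; apply: proper_card; apply/fintype.properP; split.
    by apply/fintype.subsetP => k; rewrite !inE => /prec_trans; apply.
  by exists i; rewrite !inE// /prec eqxx.
have [s [bs sP]] : exists s : 'I_n -> 'I_n, bijective s /\
    forall i j : 'I_n, (i <= j)%N -> (rank (s i) <= rank (s j))%N.
  apply: (sorted_bijection (leI := fun i j => (rank i <= rank j)%N)).
    by move=> i j; exact: leq_total.
  by move=> i j k; exact: leq_trans.
exists (J0 \o s), (eta \o s); split.
- exact: set_bij_comp_perm.
- exact: transport_family_perm.
- exact: fibered_perm.
move=> i j ij /=.
apply: null_subset (G0 (s j)).
- exact: measurable_inner_hull.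
- exact: measurableC.
move=> y hy Gy.
have [u [v [Gu Gv uy yv]]] := inner_hull_carrier (mGi _) (G0 _) hy.
have : prec (s j) (s i).
  apply/precP; split; last by exists y, u, v; rewrite uy yv.
  by rewrite (bij_eq bs) gt_eqF//.
by move/rank_lt; rewrite ltnNge sP// ltnW.
Qed.

(** [Gamma] is the union of the fibers' carriers. In a forbidden configuration, the point over the
    later atom would lie in the inner hull of the earlier fiber, which its carrier omits. *)
Lemma curtain_of_nested J eta nu : finite_mean lambda2 ->
  nested_coupling J eta nu -> curtain_martingale_coupling I lambda1 lambda2 nu.
Proof.
move=> mean2 [bijJ fam nuE nest]; split.
  exact: coupling_of_fibers fam nuE.
have mI : measurable I by exact: open_measurable.
pose S i := I `&` nested_carrier eta i.
have mS i : measurable (S i).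
  by apply: measurableI => //; exact: measurable_nested_carrier.
have S0 i : eta i (~` S i) = 0%E.
  have [etaI _ _ _] := fam.
  apply: measure_negligible; first exact: measurableC.
  rewrite /S setCI; apply: negligibleU.
  - by apply/negligibleP; [exact: measurableC|exact: etaI].
  - apply/negligibleP; last exact: null_off_nested_carrier.
    by apply: measurableC; exact: measurable_nested_carrier.
pose Gamma := \bigcup_(i in [set: 'I_n]) ([set J i] `*` S i).
have mG : measurable Gamma.
  apply: fin_bigcup_measurable => [|i _]; first exact: finite_finset.
  exact: measurableX.
have injJ := atoms_inj bijJ.
have secG i : xsection Gamma (J i) = S i.
  apply/seteqP; split => y; rewrite /xsection/= inE/=.
    by move=> [k _ [/= /injJ <-]].
  by move=> Sy; exists i.
exists Gamma; split => //.
- move=> [x y] [i _ [/= -> [Iy _]]]; split => //=; exact: atoms_in bijJ i.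
- have [_ mass marg _] := fam.
  rewrite nuE// -(probability_setT lambda2) marg//; apply: eq_bigr => i _.
  rewrite secG -[RHS](setTC_carried (mS i) measurableT (S0 i)).
  by rewrite setTI.
move=> x y y1 y2 x' y' y1' y2' xx' h h' sub.
have inG z : [set (x, y); (x, y1); (x, y2); (x', y'); (x', y1'); (x', y2')] z ->
  Gamma z by exact: sub.
have [i _ [/= xi Sy]] : Gamma (x, y) by apply: inG; do 5 left.
have [i1 _ [/= xi1 Sy1]] : Gamma (x, y1) by apply: inG; do 4 left; right.
have [i2 _ [/= xi2 Sy2]] : Gamma (x, y2) by apply: inG; do 3 left; right.
have [j _ [/= xj Sy']] : Gamma (x', y') by apply: inG; do 2 left; right.
have [j1 _ [/= xj1 Sy1']] : Gamma (x', y1') by apply: inG; left; right.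
have [j2 _ [/= xj2 Sy2']] : Gamma (x', y2') by apply: inG; right.
have ? : i1 = i by apply: injJ; rewrite -xi1.
have ? : i2 = i by apply: injJ; rewrite -xi2.
have ? : j1 = j by apply: injJ; rewrite -xj1.
have ? : j2 = j by apply: injJ; rewrite -xj2.
subst i1 i2 j1 j2.
have outer k z : S k z -> outer_hull (eta k) z by move=> [_ []].
have [ij|ji|/val_inj ij] := ltngtP i j.
- case: Sy' => _ [_]; apply; exists i => //.
  exact: outer_hull_between (outer _ _ Sy1) (outer _ _ Sy2) h.
- case: Sy => _ [_]; apply; exists j => //.
  exact: outer_hull_between (outer _ _ Sy1') (outer _ _ Sy2') h'.
- by apply: xx'; rewrite xi xj ij.
Qed.

End curtain.

(** * Connected parts *)

Lemma setT_carried (R : realType) (I : set R) (mu : {measure set R -> \bar R}) :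
  measurable I -> carried_by mu I -> mu setT = mu I.
Proof. by move=> mI cmu; rewrite -(setTC_carried mI measurableT cmu) setTI. Qed.

Lemma integral_carried (R : realType) (I : set R)
    (mu : {measure set R -> \bar R}) (f : R -> \bar R) :
  measurable I -> carried_by mu I -> measurable_fun setT f ->
  (\int[mu]_(y in I) f y = \int[mu]_y f y)%E.
Proof.
move=> mI cmu mf; have mCI := measurableC mI.
have ge0 (g : R -> \bar R) : measurable_fun setT g -> (forall y, 0 <= g y)%E ->
    (\int[mu]_(y in I) g y = \int[mu]_y g y)%E.
  move=> mg g0; rewrite [RHS](@ge0_negligible_integral _ _ _ _ _ (~` I))//.
  by rewrite setTD setCK.
rewrite [LHS]integralE [RHS]integralE !ge0//;
  by [exact: measurable_funeneg|exact: measurable_funepos].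
Qed.

Lemma finite_sum_measure_exists d (T : measurableType d) (R : realType)
    (n : nat) (P : pred 'I_n) (eta : 'I_n -> {finite_measure set T -> \bar R}) :
  exists theta : {finite_measure set T -> \bar R},
    forall B, measurable B -> theta B = (\sum_(j < n | P j) eta j B)%E.
Proof.
pose m_ (k : nat) : {measure set T -> \bar R} :=
  if insub k is Some j then (if P j then eta j else mzero) else mzero.
have mE B : msum m_ n B = (\sum_(j < n | P j) eta j B)%E.
  rewrite /msum [RHS]big_mkcond/=; apply: eq_bigr => j _.
  by rewrite /m_ valK; case: ifP.
have fin : (msum m_ n setT < +oo)%E.
  by rewrite mE; apply/lte_sum_pinfty => j _; rewrite ltey_eq fin_num_measure.
have [theta thetaE] := finite_measure_of fin.
by exists theta => B mB; rewrite thetaE; exact: mE.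
Qed.

Section connected_cdf.
Context (R : realType).
Variables eta theta : {finite_measure set R -> \bar R}.
Hypothesis disj : theta (inner_hull eta) = 0%E.

Let L : set R := [set y | eta `]-oo, y[%classic = 0%E].

Let mL : measurable L.
Proof.
apply: (@is_interval_measurable R) => x y /= Dx Dy z /andP[_ zy].
apply: null_subset Dy => // t /=; rewrite !in_itv/= => tz.
exact: lt_le_trans zy.
Qed.

(** With [a] the mass of [theta] on [L], up to and including the left end of the hull of [eta], the
    clamp has three regimes. Left of the hull, [eta] has no mass yet and [theta] at most [a].
    Inside, [theta] stays equal to [a], so the sum minus [a] is [eta]. On the right, [eta] is
    exhausted and the sum exceeds [a + eta setT], up to equality. *)
Lemma connected_cdf : exists a : R, [/\ 0 <= a, (a%:E <= theta setT)%E &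
  forall x : R, (eta `]-oo, x]%classic =
    mine (maxe (eta `]-oo, x]%classic + theta `]-oo, x]%classic - a%:E) 0)
      (eta setT))%E].
Proof.
have fin (mu : {finite_measure set R -> \bar R}) (B : set R) : measurable B ->
    mu B = (fine (mu B))%:E.
  by move=> mB; rewrite fineK// fin_num_measure.
pose F (mu : {finite_measure set R -> \bar R}) (x : R) :=
  fine (mu `]-oo, x]%classic).
exists (fine (theta L)); rewrite -fin//; split.
- exact: fine_ge0.
- exact: le_measureS.
move=> x; have mx : measurable (`]-oo, x]%classic : set R) by [].
have etaT : (eta `]-oo, x]%classic <= eta setT)%E by exact: le_measureS.
have [e0|e0] := eqVneq (eta `]-oo, x]%classic) 0%E.
  have le : (theta `]-oo, x]%classic <= theta L)%E.
    apply: le_measureS => // y /=; rewrite in_itv/= => yx.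
    apply: null_subset e0 => // t /=; rewrite !in_itv/= => ty.
    by rewrite ltW// (lt_le_trans ty).
  rewrite e0 add0e max_r; last by rewrite leeBlDr ?add0e// fin_num_measure.
  by rewrite min_l.
have Lx : L `<=` `]-oo, x]%classic.
  move=> y Ly; rewrite /= in_itv/= leNgt; apply/negP => xy.
  move/negP: e0; apply; apply/eqP; apply: null_subset Ly => // t /=.
  by rewrite !in_itv/= => tx; exact: le_lt_trans xy.
have leL : (theta L <= theta `]-oo, x]%classic)%E by exact: le_measureS.
have [t0|t0] := eqVneq (eta `]x, +oo[%classic) 0%E.
  have eT : eta setT = eta `]-oo, x]%classic.
    have -> : [set: R] = `]-oo, x]%classic `|` `]x, +oo[%classic.
      by rewrite -setCitvl setUv.
    rewrite measureU//; last by rewrite -setCitvl setICr.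
    by rewrite [X in (_ + X)%E]t0 adde0.
  rewrite eT min_r// le_max; apply/orP; left.
  rewrite -addeA leeDl// sube_ge0//.
  by rewrite fin_num_measure.
suff -> : theta `]-oo, x]%classic = theta L.
  rewrite addeK ?fin_num_measure//.
  by rewrite max_l// min_l.
rewrite -(setDUK Lx) measureU//; first last.
  by rewrite setDE setICA setICr setI0.
  exact: measurableD.
rewrite [X in (_ + X)%E](_ : _ = 0%E) ?adde0//.
apply: null_subset disj; first exact: measurableD.
  exact: measurable_inner_hull.
move=> y [/= + nLy]; rewrite in_itv/= => yx; split.
  by rewrite lt0e measure_ge0 andbT; apply/eqP.
apply: (@lt_le_trans _ _ (eta `]x, +oo[%classic)).
  by rewrite lt0e t0 measure_ge0.
apply: le_measureS => // t /=; rewrite !in_itv/= !andbT.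
exact: le_lt_trans yx.
Qed.

End connected_cdf.

Lemma sume_fin_num (R : realType) (I : Type) (r : seq I) (P : pred I)
    (f : I -> \bar R) : (forall i, f i \is a fin_num) ->
  (\sum_(i <- r | P i) f i)%E \is a fin_num.
Proof. by move=> ff; elim/big_ind: _ => // x y fx fy; rewrite fin_numD fx. Qed.

Section nested_parts.
Context (R : realType) (I : set R) (lambda1 lambda2 : probability R R).
Hypothesis I0 : I !=set0.
Hypothesis oI : open I.
Hypothesis iI : is_interval I.
Context (n : nat) (J : 'I_n -> R).
Implicit Types eta : 'I_n -> {finite_measure set R -> \bar R}.

Let mI : measurable I. Proof. exact: open_measurable. Qed.

Lemma family_integrable eta i (f : R -> \bar R) (D : set R) : measurable D ->
  transport_family I lambda1 lambda2 J eta -> lambda2.-integrable D f ->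
  (eta i).-integrable D f.
Proof.
move=> mD [_ _ marg _]; apply: (@integrable_summand _ _ _ _ lambda2 eta) => //.
Qed.

Lemma sum_split (F : 'I_n -> \bar R) (i : 'I_n) :
  (\sum_(j < n) F j = \sum_(j < n | (j < i)%N) F j +
     (F i + \sum_(j < n | (i < j)%N) F j))%E.
Proof.
rewrite (bigID (fun j : 'I_n => (j < i)%N))/=; congr (_ + _)%E.
rewrite (bigD1 i)/= ?ltnn//; congr (_ + _)%E; apply: eq_bigl => j.
by rewrite -leqNgt [RHS]ltn_neqAle andbC eq_sym.
Qed.

(** [gamma] is built as the sum of the fibers from [i] on, which makes it a measure; the form with a
    difference follows as all masses are finite. The later fibers together avoid the inner hull of
    [eta i], so [connected_cdf] applies. *)
Lemma nested_part eta (i : 'I_n) : transport_family I lambda1 lambda2 J eta ->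
  nested eta ->
  exists gamma : {finite_measure set R -> \bar R},
    (forall B : set R, measurable B ->
      gamma B = (lambda2 B - \sum_(j < n | (j < i)%N) eta j B)%E) /\
    exists a m : R, [/\ 0 <= a, 0 <= m, ((a + m)%:E <= gamma I)%E,
      eta i I = m%:E &
      forall x, I x -> (eta i (`]-oo, x] `&` I) =
        mine (maxe (gamma (`]-oo, x] `&` I) - a%:E) 0) m%:E)%E].
Proof.
move=> [etaI mass marg mean] nest.
have [theta thetaE] :=
  finite_sum_measure_exists (fun j : 'I_n => (i < j)%N) eta.
have disj : theta (inner_hull (eta i)) = 0%E.
  rewrite thetaE; last exact: measurable_inner_hull.
  by apply: big1 => j ij; exact: nest.
have [a [a0 aT aE]] := connected_cdf disj.
have gfin : (measure_add (eta i) theta setT < +oo)%E.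
  rewrite measure_addE ltey_eq fin_numD !fin_num_measure//.
have [gamma gammaE] := finite_measure_of gfin.
have gE B : measurable B -> gamma B = (eta i B + theta B)%E.
  by move=> mB; rewrite gammaE; exact: measure_addE.
exists gamma; split.
  move=> B mB; rewrite gE// marg// thetaE//.
  have fs : (\sum_(j < n | (j < i)%N) eta j B)%E \is a fin_num.
    by apply: sume_fin_num => j; rewrite fin_num_measure.
  by rewrite (sum_split (fun j => eta j B) i) [X in (X - _)%E]addeC addeK.
have thetaI : carried_by theta I.
  suff : theta (~` I) = 0%E by [].
  rewrite thetaE; last exact: measurableC.
  by apply: big1 => j _; exact: etaI.
have fm : eta i setT \is a fin_num by rewrite fin_num_measure.
exists a, (fine (eta i setT)); split => //.
- exact: fine_ge0.
- rewrite gE// EFinD fineK// addeC; apply: leeD.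
    by rewrite (setT_carried mI (etaI i)).
  by rewrite -(setT_carried mI thetaI).
- by rewrite fineK// (setT_carried mI (etaI i)).
- move=> x Ix; rewrite fineK//.
  have mx : measurable (`]-oo, x]%classic : set R) by [].
  have -> : eta i (`]-oo, x] `&` I) = eta i `]-oo, x]%classic.
    exact: (setTC_carried mI mx (etaI i)).
  have -> : gamma (`]-oo, x] `&` I) = gamma `]-oo, x]%classic.
    apply: (setTC_carried mI mx); suff : gamma (~` I) = 0%E by [].
    rewrite gE; last exact: measurableC.
    by rewrite [X in (X + _)%E]etaI [X in (_ + X)%E]thetaI adde0.
  by rewrite gE.
Qed.

Lemma family_mean_fin eta i : transport_family I lambda1 lambda2 J eta ->
  (\int[eta i]_y y%:E)%E \is a fin_num.
Proof.
move=> [_ _ _ mean]; rewrite mean fin_numM//.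
by rewrite fin_num_measure//; exact: measurable_set1.
Qed.

(** Induction along the enumeration: if the earlier fibers agree, both [i]-th fibers are connected
    parts of the same remainder, with the same mass and mean. *)
Lemma nested_unique eta eta' :
  transport_family I lambda1 lambda2 J eta -> nested eta ->
  transport_family I lambda1 lambda2 J eta' -> nested eta' ->
  forall i, Defs.eq_measure (eta i) (eta' i).
Proof.
move=> fam nest fam' nest'.
suff H k : forall i : 'I_n, (i < k)%N -> Defs.eq_measure (eta i) (eta' i).
  by move=> i; exact: (H i.+1).
elim: k => [//|k IH] i ik.
have [gamma [gE [a [m [a0 m0 am im iE]]]]] := nested_part i fam nest.
have [gamma' [gE' [a' [m' [_ _ _ im' iE']]]]] := nested_part i fam' nest'.
have mm : m = m'.
  have [c1 h1 _ _] := fam; have [c2 h2 _ _] := fam'.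
  have : m%:E = m'%:E.
    rewrite -im -im' -(setT_carried mI (c1 i)) -(setT_carried mI (c2 i)).
    by apply: etrans (h1 i) _; apply: etrans (esym (h2 i)) _.
  by case.
subst m'.
have gg B : measurable B -> gamma B = gamma' B.
  move=> mB; rewrite gE// gE'//; congr (_ - _)%E; apply: eq_bigr => j ji.
  by apply: IH => //; exact: leq_trans ji _.
have [c1 _ _ me1] := fam; have [c2 _ _ me2] := fam'.
apply: (@eq_measure_of_clamped_cdf R I (fun x => gamma (`]-oo, x] `&` I)) a a' m)
  => //.
- by move=> x Ix; rewrite iE'// gg//; exact: measurableI.
- exact: family_mean_fin fam.
- by rewrite me1 me2.
Qed.

Lemma decomposition_of_nested eta nu :
  nested_coupling I lambda1 lambda2 J eta nu ->
  connected_part_decomposition I lambda1 lambda2 n (support_in I lambda1) nu.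
Proof.
move=> [bijJ fam nuE nest].
have [etaI mass marg mean] := fam.
exists J, eta; split => //; first exact/fibered_product.
have mid : measurable_fun setT (fun y : R => y%:E) by exact/measurable_EFinP.
move=> i.
have [gamma [gE [a [m [a0 m0 am im iE]]]]] := nested_part i fam nest.
exists gamma => /=.
have mE : m%:E = lambda1 [set J i].
  by rewrite -im -(setT_carried mI (etaI i)); exact: mass.
split => //.
  split.
  - exists a, (a + m); split => //; first by rewrite lerDl.
    split; first exact: etaI.
    by move=> x Ix; rewrite addrAC subrr add0r; exact: iE.
  - by rewrite -mE; exact: im.
  - by rewrite (integral_carried mI (etaI i) mid) mean.
move=> rho [[a' [b' [a'0 ab' b'g [rhoI rhoE]]]] rhom rhoc] B mB.
(* The clamp of the competitor is at [b' - a']. Since its distribution function never exceeds its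
   mass [m], this inequality allows the clamp to be lowered to [m]. *)
have mba : m <= b' - a'.
  rewrite -lee_fin mE -rhom; apply: measure_le_of_cdf => // x Ix.
  by rewrite rhoE// ge_min lexx orbT.
symmetry; move: B mB.
apply: (@eq_measure_of_clamped_cdf R I (fun x => gamma (`]-oo, x] `&` I)) a a' m)
  => //.
- by rewrite rhom mE.
- move=> x Ix.
  have le : (rho (`]-oo, x] `&` I) <= m%:E)%E.
    rewrite mE -rhom; apply: le_measureS => //; exact: measurableI.
  rewrite -(min_l le) rhoE// -minA; congr mine.
  by rewrite min_r// lee_fin.
- exact: family_mean_fin fam.
- by rewrite mean -rhoc (integral_carried mI rhoI mid).
Qed.

End nested_parts.

(** * From connected parts back to nested fibers *)

Lemma inner_hull_in (R : realType) (I : set R)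
    (eta : {finite_measure set R -> \bar R}) : measurable I -> is_interval I ->
  carried_by eta I -> inner_hull eta `<=` I.
Proof.
move=> mI iI cI y hy.
have [u [v [Iu Iv uy yv]]] := inner_hull_carrier mI cI hy.
by apply: (iI u v) => //; rewrite !ltW.
Qed.

Lemma open_inner_hull (R : realType) (eta : {finite_measure set R -> \bar R})
    (y : R) : inner_hull eta y ->
  exists u v, [/\ inner_hull eta u, inner_hull eta v, u < y & y < v].
Proof.
move=> hy.
have [u [v [Eu Ev uy yv]]] := inner_hull_carrier (measurable_outer_hull eta)
  (null_off_outer_hull eta) hy.
exists ((u + y) / 2), ((y + v) / 2); split; last 2 first.
- lra.
- lra.
- apply: (outer_hull_between Eu Ev); lra.
- apply: (outer_hull_between Eu Ev); lra.
Qed.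

(** The hull is open, so small intervals with both ends in it cover it. Half-open intervals are used
    because their masses are increments of distribution functions. *)
Lemma null_inner_hull (R : realType)
    (eta theta : {finite_measure set R -> \bar R}) :
  (forall u v, inner_hull eta u -> inner_hull eta v -> u < v ->
    theta `]u, v]%classic = 0%E) ->
  theta (inner_hull eta) = 0%E.
Proof.
move=> H; apply: null_of_locally_null; first exact: measurable_inner_hull.
move=> y /open_inner_hull[u [v [hu hv uy yv]]].
exists `]u, v[%classic; split; first exact: interval_open.
  by rewrite /= in_itv/= uy.
apply: null_subset (H u v hu hv (lt_trans uy yv)) => // t /=.
by rewrite !in_itv/= => /andP[-> /ltW].
Qed.

Lemma clamp_interior (R : realDomainType) (x c : R) :
  0 < Num.min (Num.max x 0) c < c -> Num.min (Num.max x 0) c = x.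
Proof.
rewrite lt_min gt_min ltxx orbF lt_max ltxx orbF => /andP[/andP[x0 _]].
by rewrite max_l ?ltW// => xc; rewrite min_l// ltW.
Qed.

Section decomposition_nested.
Context (R : realType) (I : set R) (lambda1 lambda2 : probability R R).
Hypothesis I0 : I !=set0.
Hypothesis oI : open I.
Hypothesis iI : is_interval I.
Hypothesis lambda1_I : carried_by lambda1 I.
Hypothesis lambda2_I : carried_by lambda2 I.
Context (n : nat).

Let mI : measurable I. Proof. exact: open_measurable. Qed.

(** Inside the inner hull of [eta i] the clamp is inactive, so [eta i] grows there exactly like the
    remainder [gamma], and nothing is left for later fibers. *)
Lemma nested_of_decomposition (nu : {measure set (R * R) -> \bar R}) :
  connected_part_decomposition I lambda1 lambda2 n (support_in I lambda1) nu ->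
  exists J eta, nested_coupling I lambda1 lambda2 (n := n) J eta nu.
Proof.
move=> [J [eta [bijJ /fibered_product nuE parts]]]; exists J, eta.
have etaI i : carried_by (eta i) I.
  by have [gamma [_ [[a [b [_ _ _ [cI _]]]] _ _] _]] := parts i.
have mass i : eta i setT = lambda1 [set J i].
  rewrite (setT_carried mI (etaI i)).
  by have [gamma [_ [_ im _] _]] := parts i; exact: im.
have mean i : (\int[eta i]_y y%:E = lambda1 [set J i] * (J i)%:E)%E.
  rewrite -(integral_carried mI (etaI i)); last exact/measurable_EFinP.
  by have [gamma [_ [_ _ im] _]] := parts i; exact: im.
have finE (mu : {finite_measure set R -> \bar R}) (B : set R) : measurable B ->
    mu B = (fine (mu B))%:E.
  by move=> mB; rewrite fineK// fin_num_measure.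
have fins B (P : pred 'I_n) : measurable B ->
    (\sum_(j < n | P j) eta j B)%E \is a fin_num.
  by move=> mB; apply: sume_fin_num => j; rewrite fin_num_measure.
have total : (\sum_(i < n) eta i setT = 1)%E.
  rewrite -(probability_setT lambda1) (atom_sum oI lambda1_I bijJ)//.
  by apply: eq_bigr => i _; rewrite setTI; exact: mass.
(* The parts must be shown to use up [lambda2]. At the last index [l] the remainder has the mass of
   [eta l], which forces [eta l] to be the entire remainder. *)
have marg B : measurable B -> lambda2 B = (\sum_(i < n) eta i B)%E.
  move=> mB.
  have n0 : (0 < n)%N.
    rewrite lt0n; apply/eqP => n0; subst n.
    by move: total; rewrite big_ord0 => /eqP; rewrite eq_sym onee_eq0.
  pose l := Ordinal (ltac:(by rewrite prednK) : (n.-1 < n)%N).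
  have gtl (j : 'I_n) : (l < j)%N = false.
    by apply/negbTE; rewrite -leqNgt -ltnS prednK.
  have [gamma [gE [[a [b [a0 ab bg [_ cdfE]]]] _ _] _]] := parts l.
  have sumE (C : set R) : measurable C ->
      (\sum_(i < n) eta i C = \sum_(j < n | (j < l)%N) eta j C + eta l C)%E.
    move=> mC; rewrite (sum_split (fun j => eta j C) l); congr (_ + _)%E.
    by rewrite [X in (_ + X)%E]big1 ?adde0// => j; rewrite gtl.
  have gI : carried_by gamma I.
    suff : gamma (~` I) = 0%E by [].
    have mCI := measurableC mI.
    rewrite gE// [X in (X - _)%E]lambda2_I big1 ?sube0// => j _; exact: etaI.
  have gT : gamma setT = eta l setT.
    apply: etrans (gE _ measurableT) _.
    apply: etrans (congr1 (fun z => z - _)%E (probability_setT lambda2)) _.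
    rewrite -total sumE//.
    by rewrite [X in (X - _)%E]addeC addeK// fins.
  have lel : (eta l I <= (b - a)%:E)%E.
    apply: measure_le_of_cdf => // x Ix.
    by rewrite cdfE// ge_min lexx orbT.
  have gel : gamma I = eta l I.
    by rewrite -(setT_carried mI gI) -(setT_carried mI (etaI l)).
  (* The mass of [eta l] is at most [b - a], and [b] is at most that same mass. *)
  have [a00 bE] : a = 0%R /\ b%:E = eta l I.
    have bg' : (b%:E <= eta l I)%E by rewrite -gel; exact: bg.
    move: lel bg'; rewrite finE// !lee_fin => h1 h2.
    by split; [|congr EFin]; lra.
  subst a.
  have eq : Defs.eq_measure gamma (eta l).
    apply: (eq_measure_of_cdf_on I0 oI iI) => //.
    - by rewrite ltey_eq fin_num_measure.
    - move=> x Ix; rewrite [RHS]cdfE// subr0 sube0 max_l// min_l//.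
      by rewrite bE -gel; apply: le_measureS => //; exact: measurableI.
  have e : gamma B = eta l B by exact: eq.
  by rewrite sumE// -e gE// addeC subeK// fins.
split => //.
move=> i j ij; apply: null_inner_hull => u v hu hv uv.
have [gamma [gE [[a [b [a0 ab bg [_ cdfE]]]] _ _] _]] := parts i.
have Iu := inner_hull_in mI iI (etaI i) hu.
have Iv := inner_hull_in mI iI (etaI i) hv.
have gsum B : measurable B ->
    gamma B = (eta i B + \sum_(k < n | (i < k)%N) eta k B)%E.
  move=> mB; apply: etrans (gE B mB) _.
  apply: etrans (congr1 (fun z => z - _)%E (marg B mB)) _.
  rewrite (sum_split (fun k => eta k B) i).
  by rewrite [X in (X - _)%E]addeC addeK// fins.
have gI : carried_by gamma I.
  suff : gamma (~` I) = 0%E by [].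
  have mCI := measurableC mI.
  rewrite gsum// [X in (X + _)%E]etaI add0e big1// => k _; exact: etaI.
have cdf x : I x -> eta i `]-oo, x]%classic =
    (mine (maxe (gamma `]-oo, x]%classic - a%:E) 0) (b - a)%:E)%E.
  move=> Ix; rewrite -(setTC_carried mI (measurable_itv _) (etaI i)).
  rewrite -(setTC_carried mI (measurable_itv _) gI); exact: cdfE.
pose F (mu : {finite_measure set R -> \bar R}) (x : R) :=
  fine (mu `]-oo, x]%classic).
have FE (mu : {finite_measure set R -> \bar R}) (x : R) :
    mu `]-oo, x]%classic = (F mu x)%:E by rewrite -finE.
have Fcdf x : I x -> F (eta i) x = Num.min (Num.max (F gamma x - a) 0) (b - a).
  move=> Ix; have := cdf x Ix; rewrite !FE -EFinB -EFin_max -EFin_min.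
  by case.
have ocE (mu : {finite_measure set R -> \bar R}) :
    mu `]u, v]%classic = (F mu v - F mu u)%:E.
  have -> : `]u, v]%classic = `]-oo, v]%classic `\` `]-oo, u]%classic :> set R.
    apply/seteqP; split => [t|t []] /=; rewrite !in_itv/=.
      by move=> /andP[ut tv]; split => //; apply/negP; rewrite -ltNge.
    by move=> -> /negP; rewrite -ltNge andbT.
  rewrite measureD//; last by rewrite ltey_eq fin_num_measure.
  rewrite (_ : _ `&` _ = `]-oo, u]%classic).
    by rewrite EFinB; congr (_ - _)%E; exact: FE.
  apply/seteqP; split => [t []//|t /=]; rewrite !in_itv/= => tu.
  by split; rewrite ?in_itv/= ?(le_trans tu)// ltW.
have Fu : 0 < F (eta i) u.
  have [h _] := hu; rewrite -lte_fin -FE; apply: lt_le_trans h _.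
  by apply: le_measureS => // t /=; rewrite !in_itv/=; exact: ltW.
have Fv : F (eta i) v < b - a.
  have le : (eta i I <= (b - a)%:E)%E.
    by apply: measure_le_of_cdf => // x Ix; rewrite cdfE// ge_min lexx orbT.
  have eT : (eta i I = eta i `]-oo, v]%classic + eta i `]v, +oo[%classic)%E.
    rewrite -(setT_carried mI (etaI i)) -measureU//; last first.
      by rewrite -setCitvl setICr.
    by congr (eta i _); rewrite -setCitvl setUv.
  rewrite -lte_fin; apply: lt_le_trans le; rewrite eT -FE lteDl.
    by case: hv.
  by rewrite fin_num_measure.
have FF : F (eta i) u <= F (eta i) v.
  rewrite -lee_fin -!FE; apply: le_measureS => // t /=; rewrite !in_itv/= => tu.
  by rewrite (le_trans tu)// ltW.
(* At [u] and [v] the distribution function of [eta i] is strictly between [0] and [b - a], so there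
   it equals that of [gamma] minus [a]. *)
have ocg : gamma `]u, v]%classic = eta i `]u, v]%classic.
  rewrite !ocE; congr EFin.
  have vE : F (eta i) v = F gamma v - a.
    rewrite Fcdf//; apply: clamp_interior; rewrite -Fcdf// Fv andbT.
    exact: lt_le_trans FF.
  have uE : F (eta i) u = F gamma u - a.
    rewrite Fcdf//; apply: clamp_interior; rewrite -Fcdf// Fu.
    exact: le_lt_trans FF _.
  by rewrite vE uE; lra.
have s0 : (\sum_(k < n | (i < k)%N) eta k `]u, v]%classic = 0)%E.
  have e := gsum `]u, v]%classic (measurable_itv _).
  rewrite -[LHS](@addeK _ (eta i `]u, v]%classic)) ?fin_num_measure//.
  by rewrite [X in (X - _)%E]addeC -e ocg subee// fin_num_measure.
apply/eqP; rewrite eq_le measure_ge0 andbT -s0 (bigD1 j)//= leeDl//.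
by apply: sume_ge0.
Qed.

End decomposition_nested.

(** * Concave functions *)

Section concave.
Context (R : realType).
Implicit Types (D : set R) (u f : R -> R).

(** The chord inequality with denominators cleared, a form suited to polynomial arithmetic. *)
Definition concave_on D u : Prop := forall x y z, D x -> D y -> D z ->
  x < y -> y < z -> (z - y) * u x + (y - x) * u z <= (z - x) * u y.

Lemma strictly_concave3 D f x y z : strictly_concave_on D f ->
  D x -> D z -> x < y -> y < z ->
  (z - y) * f x + (y - x) * f z < (z - x) * f y.
Proof.
move=> cf Dx Dz xy yz.
have zx : 0 < z - x by lra.
have t01 : 0 < (z - y) / (z - x) < 1.
  apply/andP; split; first by apply: divr_gt0; lra.
  by rewrite ltr_pdivrMr// mul1r; lra.
have xz : x <> z by move=> E; move: zx; rewrite E; lra.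
have := cf x z _ Dx Dz xz t01.
have -> : (z - y) / (z - x) * x + (1 - (z - y) / (z - x)) * z = y.
  by field; rewrite gt_eqF.
rewrite -(ltr_pM2l zx); congr (_ < _).
by field; rewrite gt_eqF.
Qed.

Lemma strictly_concave_concave D f :
  strictly_concave_on D f -> concave_on D f.
Proof.
by move=> cf x y z Dx Dy Dz xy yz; apply: ltW; exact: strictly_concave3 cf _ _ _ _.
Qed.

(** The slope is the supremum of the chord slopes to the right of [p], which are bounded by every
    chord slope to its left. The points [a] and [b] make both families nonempty. *)
Lemma concave_supergradient D u p a b : is_interval D -> concave_on D u ->
  D a -> D b -> a < p -> p < b ->
  exists s, forall z, D z -> u z <= u p + s * (z - p).
Proof.
move=> iD cu Da Db ap pb.
have Dp : D p by apply: (iD a b) => //; rewrite !ltW.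
pose S : set R := [set r | exists2 z, D z & p < z /\ r = (u z - u p) / (z - p)].
have leS w z : D w -> D z -> w < p -> p < z ->
    (u z - u p) / (z - p) <= (u p - u w) / (p - w).
  move=> Dw Dz wp pz; have := cu _ _ _ Dw Dp Dz wp pz.
  rewrite ler_pdivrMr ?subr_gt0// mulrAC ler_pdivlMr ?subr_gt0//; nra.
have Sub : has_sup S.
  split; first by exists ((u b - u p) / (b - p)), b.
  by exists ((u p - u a) / (p - a)) => _ [z Dz [pz ->]]; exact: leS.
exists (sup S) => z Dz.
have [zp|pz|->] := ltgtP z p; last by rewrite subrr mulr0 addr0.
  have : sup S <= (u p - u z) / (p - z).
    by apply: ge_sup => [|_ [t Dt [pt ->]]]; [case: Sub|exact: leS].
  rewrite ler_pdivlMr ?subr_gt0//; nra.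
have : (u z - u p) / (z - p) <= sup S.
  by apply: sup_ubound; [case: Sub|exists z].
rewrite ler_pdivrMr ?subr_gt0//; lra.
Qed.

(** Lipschitz continuity; exchanging [x] and [y] gives the other inequality. It yields integrability
    against any finite measure with a mean, and affine bounds on half-lines. *)
Definition slope_bounded u : Prop :=
  exists2 K, 0 <= K & forall x y, u x <= u y + K * `|x - y|.

Lemma concave_lincomb u (c a b : R) : 0 <= c -> concave_on setT u ->
  concave_on setT (fun y => c * u y + (a + b * y)).
Proof.
move=> c0 cu x y z _ _ _ xy yz.
have := ler_wpM2l c0 (cu x y z Logic.I Logic.I Logic.I xy yz); nra.
Qed.

Lemma slope_bounded_lincomb u (c a b : R) : 0 <= c -> slope_bounded u ->
  slope_bounded (fun y => c * u y + (a + b * y)).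
Proof.
move=> c0 [K K0 uK]; exists (c * K + `|b|); first by rewrite addr_ge0// mulr_ge0.
move=> x y; have h1 := ler_wpM2l c0 (uK x y).
have h2 : b * (x - y) <= `|b| * `|x - y| by rewrite -normrM ler_norm.
nra.
Qed.

Lemma concave_min u v : concave_on setT u -> concave_on setT v ->
  concave_on setT (fun y => Num.min (u y) (v y)).
Proof.
move=> cu cv x y z _ _ _ xy yz.
have h1 := cu x y z Logic.I Logic.I Logic.I xy yz.
have h2 := cv x y z Logic.I Logic.I Logic.I xy yz.
have ux : Num.min (u x) (v x) <= u x by rewrite ge_min lexx.
have vx : Num.min (u x) (v x) <= v x by rewrite ge_min lexx orbT.
have uz : Num.min (u z) (v z) <= u z by rewrite ge_min lexx.
have vz : Num.min (u z) (v z) <= v z by rewrite ge_min lexx orbT.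
have [_|_] := leP (u y) (v y).
  by apply: le_trans h1; apply: lerD; apply: ler_wpM2l => //; lra.
by apply: le_trans h2; apply: lerD; apply: ler_wpM2l => //; lra.
Qed.

Lemma slope_bounded_min u v : slope_bounded u -> slope_bounded v ->
  slope_bounded (fun y => Num.min (u y) (v y)).
Proof.
move=> [K K0 uK] [K' K'0 vK]; exists (K + K'); first exact: addr_ge0.
move=> x y; have h1 := uK x y; have h2 := vK x y.
have n0 : 0 <= `|x - y| by [].
have ux : Num.min (u x) (v x) <= u x by rewrite ge_min lexx.
have vx : Num.min (u x) (v x) <= v x by rewrite ge_min lexx orbT.
by have [_|_] := leP (u y) (v y); nra.
Qed.

(** The superlevel sets are intervals. *)
Lemma concave_measurable D u : measurable D -> is_interval D ->
  concave_on D u -> measurable_fun D u.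
Proof.
move=> mD iD cu mD'; apply: (measurability _ (RGenOInfty.measurableE R)) => //.
move=> _ [_ [c ->] <-]; apply: (@is_interval_measurable R).
move=> x z [Dx] /=; rewrite in_itv/= andbT => ux [Dz]; rewrite in_itv/= andbT.
move=> uz y /andP[xy yz]; have Dy : D y by apply: (iD x z) => //; apply/andP.
split => //; rewrite /= in_itv/= andbT.
move: xy; rewrite le_eqVlt => /predU1P[<-//|xy].
move: yz; rewrite le_eqVlt => /predU1P[->//|yz].
have h := cu x y z Dx Dy Dz xy yz.
rewrite -subr_gt0 -(pmulr_rgt0 _ (_ : 0 < z - x)); last by lra.
nra.
Qed.

End concave.

(** * Dual certificate *)

Section certificate.
Context (R : realType).

(* [E] and [C] play the roles of the closed and open convex hull of the support
   of a fiber, the graph of an affine function being fitted to that of [u] at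
   the common endpoints. *)
Definition separable (E C : set R) : Prop :=
  forall u : R -> R, concave_on setT u -> slope_bounded u ->
  exists a b : R, (forall y, E y -> a + b * y <= u y) /\
                  (forall y, ~ C y -> u y <= a + b * y).

(** If the hull has two distinct ends, the chord of [u] through them works; if they coincide, a
    supergradient does. With a single end, it is the line through it of slope [- K] (left end) or
    [K] (right end), [K] being a Lipschitz constant. The point [y0] excludes a hull without ends. *)
Lemma separable_hulls (eta : {finite_measure set R -> \bar R}) :
  eta setT != 0%E -> (exists y, ~ inner_hull eta y) ->
  separable (outer_hull eta) (inner_hull eta).
Proof.
move=> eT [y0 ny0] u cu [K K0 uK].
pose L : set R := [set y | eta `]-oo, y[%classic = 0%E].
pose U : set R := [set y | eta `]y, +oo[%classic = 0%E].
have [e Ee] : outer_hull eta !=set0.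
  apply/set0P/eqP => E0; have := null_off_outer_hull eta.
  by rewrite E0 setC0; move/eqP: eT.
have notC y : ~ inner_hull eta y -> L y \/ U y.
  move=> nC; apply: contrapT => /not_orP[nL nU]; apply: nC.
  by split; rewrite lt0e measure_ge0 andbT; apply/eqP.
have LE y z : L y -> outer_hull eta z -> y <= z.
  move=> Ly [z1 _]; rewrite leNgt; apply/negP => zy; move: z1.
  rewrite (null_subset _ _ _ Ly) ?ltxx// => t /=; rewrite !in_itv/= => tz.
  exact: le_lt_trans zy.
have UE y z : U y -> outer_hull eta z -> z <= y.
  move=> Uy [_ z2]; rewrite leNgt; apply/negP => yz; move: z2.
  rewrite (null_subset _ _ _ Uy) ?ltxx// => t /=; rewrite !in_itv/= !andbT.
  exact: lt_le_trans yz.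
have Lsup : L !=set0 -> exists p, [/\ forall y, L y -> y <= p,
    forall y, outer_hull eta y -> p <= y & p <= e].
  move=> L0; have ubE y : outer_hull eta y -> ubound L y.
    by move=> Ey t Lt; exact: LE.
  have sL : has_sup L by split => //; exists e; exact: ubE.
  exists (sup L); split => [y Ly|y Ey|].
  - by apply: sup_ubound => //; case: sL.
  - by apply: ge_sup => //; exact: ubE.
  - by apply: ge_sup => //; exact: ubE.
have Uinf : U !=set0 -> exists q, [/\ forall y, U y -> q <= y,
    forall y, outer_hull eta y -> y <= q & e <= q].
  move=> U0; have lbE y : outer_hull eta y -> lbound U y.
    by move=> Ey t Ut; exact: UE.
  have sU : has_inf U by split => //; exists e; exact: lbE.
  exists (inf U); split => [y Uy|y Ey|].
  - by apply: inf_lbound => //; case: sU.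
  - by apply: lb_le_inf => //; exact: lbE.
  - by apply: lb_le_inf => //; exact: lbE.
have [/Lsup[p [Lp pE pe]]|nL] := pselect (L !=set0);
    have [/Uinf[q [Uq qE eq]]|nU] := pselect (U !=set0).
- have [pq|qp|pq] := ltgtP p q; last 2 first.
  + by move: (le_trans pe eq); rewrite leNgt qp.
  + subst q.
    have [s us] : exists s, forall z, setT z -> u z <= u p + s * (z - p).
      apply: (@concave_supergradient R setT u p (p - 1) (p + 1)) => //; lra.
    exists (u p - s * p), s; split => y.
      move=> Ey; have <- : p = y by apply/eqP; rewrite eq_le pE// qE.
      by lra.
    by move=> _; have := us y Logic.I; lra.
  pose s := (u q - u p) / (q - p).
  have sE : s * (q - p) = u q - u p by rewrite /s divfK// subr_eq0 gt_eqF.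
  have qp : 0 < q - p by lra.
  exists (u p - s * p), s; split => y.
    move=> Ey; have := pE y Ey; rewrite le_eqVlt => /predU1P[<-|py]; first by lra.
    have := qE y Ey; rewrite le_eqVlt => /predU1P[->|yq]; first by lra.
    have h := cu p y q Logic.I Logic.I Logic.I py yq.
    rewrite -(ler_pM2l qp); nra.
  move=> /notC[/Lp|/Uq]; rewrite le_eqVlt => /predU1P[E|lt].
  + by rewrite E; lra.
  + have h := cu y p q Logic.I Logic.I Logic.I lt pq.
    rewrite -(ler_pM2l qp); nra.
  + by rewrite -E; lra.
  + have h := cu p q y Logic.I Logic.I Logic.I pq lt.
    rewrite -(ler_pM2l qp); nra.
- exists (u p + K * p), (- K); split => y.
    move=> Ey; have := uK p y; rewrite ler0_norm; last by have := pE y Ey; lra.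
    lra.
  move=> /notC[Ly|Uy]; last by case: nU; exists y.
  have := uK y p; rewrite ler0_norm; last by have := Lp y Ly; lra.
  lra.
- exists (u q - K * q), K; split => y.
    move=> Ey; have := uK q y; rewrite ger0_norm; last by have := qE y Ey; lra.
    lra.
  move=> /notC[Ly|Uy]; first by case: nL; exists y.
  have := uK y q; rewrite ger0_norm; last by have := Uq y Uy; lra.
  lra.
- by case: (notC _ ny0) => h; [case: nL|case: nU]; exists y0.
Qed.

(* Backward induction: prepending the index [0], the affine correction of
   [g 0 * f] is the one that separates [g 0 * f] from the maximum of the
   corrected functions of larger index. *)
Lemma dual_certificate (f : R -> R) (n : nat) (g : nat -> R)
    (E C : nat -> set R) :
  concave_on setT f -> slope_bounded f ->
  (forall i, (i < n)%N -> g i.+1 <= g i) ->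
  (forall i, (i < n)%N -> separable (E i) (C i)) ->
  exists (psi : R -> R) (a b : nat -> R),
  [/\ forall G, g 0%N <= G -> concave_on setT (fun y => G * f y - psi y) /\
                             slope_bounded (fun y => G * f y - psi y),
      forall i y, (i <= n)%N -> g i * f y - (a i + b i * y) <= psi y &
      forall i y, (i <= n)%N -> ((i < n)%N -> E i y) ->
        (forall k, (k < i)%N -> ~ C k y) ->
        g i * f y - (a i + b i * y) = psi y].
Proof.
move=> cf lf; elim: n => [|n IH] in g E C *.
  (* The last index gets no correction: [psi] is its own function. *)
  move=> _ _; exists (fun y => g 0%N * f y), (fun=> 0), (fun=> 0); split.
  - move=> G gG; have G0 : 0 <= G - g 0%N by rewrite subr_ge0.
    have -> : (fun y => G * f y - g 0%N * f y) =
        (fun y => (G - g 0%N) * f y + (0 + 0 * y)).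
      by apply/funext => y; ring.
    by split; [exact: concave_lincomb|exact: slope_bounded_lincomb].
  - by move=> i y; rewrite leqn0 => /eqP ->; rewrite mul0r addr0 subr0.
  - by move=> i y; rewrite leqn0 => /eqP ->; rewrite mul0r addr0 subr0.
move=> gS sepS.
have [psi [a [b [conc le eq]]]] := IH (g \o S) (E \o S) (C \o S)
  (fun i h => gS i.+1 h) (fun i h => sepS i.+1 h).
have [cu lu] := conc (g 0%N) (gS 0%N isT).
have [a0 [b0 [inE outC]]] := sepS 0%N isT _ cu lu.
exists (fun y => Num.max (psi y) (g 0%N * f y - (a0 + b0 * y))).
exists (fun i => if i is i'.+1 then a i' else a0).
exists (fun i => if i is i'.+1 then b i' else b0).
split.
(* Subtracting a maximum gives a minimum of two concave functions, the second being a nonnegative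
   multiple of [f] plus an affine function. Quantifying over all [G] above [g 0] lets the next step
   choose its own coefficient. *)
- move=> G gG; have G0 : 0 <= G - g 0%N by rewrite subr_ge0.
  have [cG lG] := conc G (le_trans (gS 0%N isT) gG).
  have -> : (fun y => G * f y - Num.max (psi y) (g 0%N * f y - (a0 + b0 * y))) =
      (fun y => Num.min (G * f y - psi y) ((G - g 0%N) * f y + (a0 + b0 * y))).
    apply/funext => y; rewrite oppr_max addr_minr; congr Num.min; ring.
  split; first by apply: concave_min => //; exact: concave_lincomb.
  by apply: slope_bounded_min => //; exact: slope_bounded_lincomb.
- move=> [|i] y h; first by rewrite le_max lexx orbT.
  by rewrite le_max le.
- move=> [|i] y h Ei Ck.
    by rewrite max_r//; have := inE y (Ei isT); lra.
  rewrite (eq i y h) => [||k ki]; [|exact: Ei|exact: (Ck k.+1)].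
  by rewrite max_l//; have := outC y (Ck 0%N isT); lra.
Qed.

End certificate.

(** * Integrals over the fibers and optimality of nested families *)

Section tensor_integral.
Context (R : realType) (I : set R) (n : nat) (J : 'I_n -> R).
Variables (nu : {measure set (R * R) -> \bar R})
  (eta : 'I_n -> {finite_measure set R -> \bar R}).
Hypothesis nuE : fibered J nu eta.
Hypothesis mI : measurable I.
Hypothesis JI : forall i, I (J i).

Lemma integral_tensor (f g : R -> R) :
  measurable_fun I g -> measurable_fun I f ->
  (forall i, (eta i).-integrable I (fun y => (f y)%:E)) ->
  (\int[nu]_(z in I `*` I) (tensor g f z)%:E =
   \sum_(i < n) (g (J i))%:E * \int[eta i]_(y in I) (f y)%:E)%E.
Proof.
move=> mg mf intf.
have mII : measurable (I `*` I) by exact: measurableX.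
have xII i : xsection (I `*` I) (J i) = I.
  apply/seteqP; split => y; rewrite /xsection/= inE/=; first by case.
  by move=> Iy; split => //; exact: JI.
have mt : measurable_fun (I `*` I) (EFin \o tensor g f).
  apply/measurable_EFinP; apply: measurable_funM.
    apply: (@measurable_comp _ _ _ _ _ _ I) => //; first by move=> _ [z [? _] <-].
    by apply: measurable_funTS; exact: measurable_fst.
  apply: (@measurable_comp _ _ _ _ _ _ I) => //; first by move=> _ [z [_ ?] <-].
  by apply: measurable_funTS; exact: measurable_snd.
have it : nu.-integrable (I `*` I) (EFin \o tensor g f).
  apply: (integrable_fibered nuE) => // i; rewrite xII.
  apply: eq_integrable (integrableZl mI (g (J i)) (intf i)) => //.
rewrite (integral_fibered nuE)//; apply: eq_bigr => i _; rewrite xII.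
by rewrite -integralZl//; exact: intf.
Qed.

End tensor_integral.

Section integrability.
Context (R : realType) (I : set R) (mu : {finite_measure set R -> \bar R}).
Hypothesis mu_mean : finite_mean mu.

Lemma slope_bounded_integrable (h : R -> R) :
  slope_bounded h -> measurable_fun setT h ->
  mu.-integrable setT (EFin \o h).
Proof.
move=> [K K0 hK] mh.
apply: (@le_integrable _ _ _ mu setT measurableT _
  (fun y => (`|h 0%R| + K * `|y|)%:E)) => //.
- exact/measurable_EFinP.
- move=> y _ /=; rewrite lee_fin [leRHS]ger0_norm; last first.
    by rewrite addr_ge0// mulr_ge0.
  have h1 := hK y 0; have h2 := hK 0 y.
  rewrite subr0 in h1; rewrite sub0r normrN in h2.
  have := ler_norm (h 0); have := ler_norm (- h 0); rewrite normrN => a1 a2.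
  by rewrite ler_norml; apply/andP; split; lra.
- apply: (@eq_integrable _ _ _ mu setT measurableT
    (fun y : R => (`|h 0|)%:E + K%:E * `|y%:E|)%E) => //.
  apply: integrableD => //; first exact: finite_measure_integrable_cst.
  by apply: integrableZl => //; exact: integrable_abse.
Qed.

End integrability.

Section optimality.
Context (R : realType) (I : set R) (lambda1 lambda2 : probability R R).
Hypothesis oI : open I.
Hypothesis lambda1_I : carried_by lambda1 I.
Hypothesis lambda2_mean : finite_mean lambda2.
Context (n : nat) (J : 'I_n -> R).
Hypothesis bijJ : set_bij [set: 'I_n] (support_in I lambda1) J.
Implicit Types eta theta : 'I_n -> {finite_measure set R -> \bar R}.

Let mI : measurable I. Proof. exact: open_measurable. Qed.

Lemma family_optimal eta theta (f : R -> R) (g : nat -> R) :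
  concave_on setT f -> slope_bounded f -> (forall i, g i.+1 <= g i) ->
  transport_family I lambda1 lambda2 J eta -> nested eta ->
  transport_family I lambda1 lambda2 J theta ->
  (\sum_(i < n) (g i)%:E * \int[theta i]_y (f y)%:E <=
   \sum_(i < n) (g i)%:E * \int[eta i]_y (f y)%:E)%E.
Proof.
move=> cf lf gS fam nest fam'.
have [n0|n0] := posnP n.
  by rewrite !big1// => -[i h]; exfalso; move: h; rewrite n0.
have mf : measurable_fun setT f by exact: concave_measurable.
(* [dual_certificate] is indexed by natural numbers; the values beyond [n] are arbitrary. *)
pose E (k : nat) : set R :=
  if insub k is Some i then outer_hull (eta i) else setT.
pose C (k : nat) : set R :=
  if insub k is Some i then inner_hull (eta i) else setT.
have EE (i : 'I_n) : E i = outer_hull (eta i) by rewrite /E valK.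
have CE (i : 'I_n) : C i = inner_hull (eta i) by rewrite /C valK.
have [_ mass _ _] := fam.
have eT0 i : eta i setT != 0%E.
  by apply/eqP => e0; have := atom_gt0 oI lambda1_I bijJ i; rewrite -mass e0 ltxx.
pose l := Ordinal (ltac:(by rewrite prednK) : (n.-1 < n)%N).
(* The hull of a fiber before the last is not the whole line: the last fiber has positive mass and
   does not charge it. *)
have sepE i : (i < n.-1)%N -> separable (E i) (C i).
  move=> ilt; have i_n : (i < n)%N by rewrite (leq_trans ilt)// leq_pred.
  rewrite -[i]/(val (Ordinal i_n)) EE CE; apply: separable_hulls => //.
  apply: contrapT => no; have := nest (Ordinal i_n) l ilt.
  rewrite (_ : inner_hull _ = setT); first by move/eqP; exact/negP/eT0.
  by apply/seteqP; split => // y _; apply: contrapT => ny; apply: no; exists y.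
have [psi [a [b [conc le eq]]]] :=
  dual_certificate cf lf (fun i (_ : (i < n.-1)%N) => gS i) sepE.
(* The certificate gives regularity of [g 0 * f - psi] only; that of [psi] is deduced by
   subtraction. *)
have [cw lw] := conc (g 0%N) (lexx _).
pose w y := g 0%N * f y - psi y.
have mw : measurable_fun setT w by exact: concave_measurable.
have int2 (h : R -> R) : slope_bounded h -> measurable_fun setT h ->
    lambda2.-integrable setT (EFin \o h).
  exact: (@slope_bounded_integrable R lambda2).
have if2 : lambda2.-integrable setT (EFin \o f) by exact: int2.
have iw2 : lambda2.-integrable setT (EFin \o w) by exact: int2.
have ipsi2 : lambda2.-integrable setT (EFin \o psi).
  apply: (@eq_integrable _ _ _ lambda2 setT measurableT
      (fun y : R => (g 0%N)%:E * (f y)%:E - (w y)%:E)%E) => //.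
    by move=> y _ /=; rewrite -EFinM -EFinB; congr EFin; rewrite /w; ring.
  by apply: integrableB => //; exact: integrableZl.
pose phi (i : 'I_n) y := g i * f y - (a i + b i * y).
pose aff (i : 'I_n) y := a i + b i * y.
have iaff i (mu : {finite_measure set R -> \bar R}) :
   (forall h, lambda2.-integrable setT h -> mu.-integrable setT h) ->
   mu.-integrable setT (EFin \o aff i).
  move=> H; apply: H; apply: int2; last first.
    by apply: measurable_funD => //; exact: measurable_funM.
  exists `|b i| => // x y; rewrite /aff.
  have : b i * (x - y) <= `|b i| * `|x - y| by rewrite -normrM ler_norm.
  lra.
have iphi i (mu : {finite_measure set R -> \bar R}) :
   (forall h, lambda2.-integrable setT h -> mu.-integrable setT h) ->
   mu.-integrable setT (EFin \o phi i).
  move=> H.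
  apply: (@eq_integrable _ _ _ mu setT measurableT
      (fun y : R => (g i)%:E * (f y)%:E - (aff i y)%:E)%E) => //.
  by apply: integrableB => //; [apply: integrableZl => //; exact: H|exact: iaff].
have famint (mu : 'I_n -> {finite_measure set R -> \bar R}) :
    transport_family I lambda1 lambda2 J mu -> forall i h,
    lambda2.-integrable setT h -> (mu i).-integrable setT h.
  by move=> fm i h ih; exact: family_integrable fm ih.
(* The integral of the affine correction depends only on the mass and the mean of the fiber, hence
   is common to all families over [J]. *)
have splitE (mu : 'I_n -> {finite_measure set R -> \bar R}) :
    transport_family I lambda1 lambda2 J mu -> forall i : 'I_n,
   ((g i)%:E * \int[mu i]_y (f y)%:E =
    \int[mu i]_y (phi i y)%:E +
    ((a i)%:E * lambda1 [set J i] + (b i)%:E * (lambda1 [set J i] * (J i)%:E)))%E.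
  move=> fm i; have H := famint _ fm i.
  have [_ mass' _ mean'] := fm.
  rewrite -integralZl//; last exact: H.
  have -> : (\int[mu i]_y ((g i)%:E * (f y)%:E) =
      \int[mu i]_y ((phi i y)%:E + (aff i y)%:E))%E.
    by apply: eq_integral => y _; rewrite -EFinM -EFinD; congr EFin;
      rewrite /phi /aff; ring.
  rewrite integralD//; [|exact: iphi|exact: iaff]; congr (_ + _)%E.
  have -> : (\int[mu i]_y (aff i y)%:E =
      \int[mu i]_y ((a i)%:E + (b i)%:E * y%:E))%E by [].
  rewrite integralD//.
  - rewrite integralZl//; last exact: H _ lambda2_mean.
    rewrite integral_cst// mean'; congr (_ * _ + _)%E; exact: mass'.
  - exact: finite_measure_integrable_cst.
  - by apply: integrableZl => //; exact: H _ lambda2_mean.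
under eq_bigr do rewrite (splitE _ fam').
under [leRHS]eq_bigr do rewrite (splitE _ fam).
rewrite [leLHS]big_split [leRHS]big_split; apply: leeD2r.
have psiE (mu : 'I_n -> {finite_measure set R -> \bar R}) :
    transport_family I lambda1 lambda2 J mu ->
    (\sum_(i < n) \int[mu i]_y (psi y)%:E = \int[lambda2]_y (psi y)%:E)%E.
  by move=> [_ _ marg _]; rewrite -(integral_sum_measures marg).
(* The sum of the integrals of [psi] is its integral against [lambda2], the same for both families:
   [theta] stays below it by [phi i <= psi], and [eta] attains it. *)
apply: (@le_trans _ _ (\sum_(i < n) \int[theta i]_y (psi y)%:E)%E).
  apply: lee_sum => i _; have H := famint _ fam' i.
  apply: le_integral => //; [exact: iphi|exact: H|move=> y _].
  by rewrite lee_fin; apply: le; rewrite -ltnS prednK.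
rewrite psiE// -(psiE _ fam); apply: lee_sum => i _.
have H := famint _ fam i.
have mS := measurable_nested_carrier eta i.
(* On the nested carrier of index [i] the conditions for [phi i = psi] hold at every point. *)
have S0 := null_off_nested_carrier i nest.
have red h : (eta i).-integrable setT h ->
    (\int[eta i]_y h y = \int[eta i]_(y in nested_carrier eta i) h y)%E.
  move=> ih; rewrite (negligible_integral (measurableC mS) measurableT ih S0).
  by rewrite setTD setCK.
rewrite red; last exact: H.
rewrite [leRHS]red; last exact: iphi.
rewrite le_eqVlt; apply/orP; left; apply/eqP; apply: eq_integral => y.
rewrite inE => -[Ey nCy] /=; congr EFin; symmetry; apply: eq.
- by rewrite -ltnS prednK.
- by rewrite EE.
- move=> k ki Cy; apply: nCy.
  have kn : (k < n)%N by exact: ltn_trans ki _.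
  by exists (Ordinal kn) => //; rewrite -CE.
Qed.

End optimality.

(** * Exchange of mass between two fibers *)

Section exchange.
Context (R : realType).
Implicit Types eta theta mu : {finite_measure set R -> \bar R}.

Lemma integral_restriction (eta : {measure set R -> \bar R}) (D : set R)
    (mD : measurable D) (f : R -> \bar R) :
  measurable_fun setT f -> (forall x, 0 <= f x)%E ->
  (\int[mrestr eta mD]_x f x = \int[eta]_(x in D) f x)%E.
Proof.
move=> mf f0.
rewrite (@ge0_negligible_integral _ _ _ _ setT (~` D))//.
- rewrite setTD setCK; apply: eq_measure_integral => A mA AD.
  by rewrite /= /mrestr setIidl.
- exact: measurableC.
- by rewrite /= /mrestr setICl measure0.
Qed.

(** The measure is specified by its integrals, the only access the exchange needs; indicators give
    back its values on sets. *)
Lemma scaled_part_exists eta (k : R) (D : set R) : 0 <= k -> measurable D ->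
  exists mu, forall f : R -> \bar R, eta.-integrable setT f ->
    mu.-integrable setT f /\
    (\int[mu]_x f x = k%:E * \int[eta]_(x in D) f x)%E.
Proof.
move=> k0 mD.
pose nu : {measure set R -> \bar R} := mscale (NngNum k0) (mrestr eta mD).
have nuT : (nu setT < +oo)%E.
  rewrite /nu /= /mscale /= /mrestr ltey_eq fin_numM// fin_num_measure//.
  exact: measurableI.
have [mu muE] := finite_measure_of nuT.
have ge0E f : measurable_fun setT f -> (forall x, 0 <= f x)%E ->
    (\int[mu]_x f x = k%:E * \int[eta]_(x in D) f x)%E.
  move=> mf f0; rewrite (eq_measure_integral nu) => [|A _ _]; last exact: muE.
  by rewrite ge0_integral_mscale//= integral_restriction.
exists mu => f intf.
have mf := measurable_int _ intf.
have intD : eta.-integrable D f by exact: integrableS intf.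
split.
  apply/integrableP; split => //.
  rewrite ge0E//; last exact: measurableT_comp.
  have /integrableP[_ h] := intD.
  by rewrite lte_mul_pinfty// ?lee_fin.
rewrite integralE ge0E//; last exact: measurable_funepos.
rewrite ge0E//; last exact: measurable_funeneg.
rewrite [in RHS]integralE.
rewrite -(fineK (integrable_pos_fin_num mD intD)).
rewrite -(fineK (integrable_neg_fin_num mD intD)).
by rewrite -!EFinM -!EFinB mulrBr.
Qed.

Lemma sum_measure_exists eta theta :
  exists mu, forall f : R -> \bar R,
    eta.-integrable setT f -> theta.-integrable setT f ->
    mu.-integrable setT f /\
    (\int[mu]_x f x = \int[eta]_x f x + \int[theta]_x f x)%E.
Proof.
pose nu : {measure set R -> \bar R} := measure_add eta theta.
have nuT : (nu setT < +oo)%E.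
  have -> : nu setT = (eta setT + theta setT)%E by exact: measure_addE.
  by rewrite ltey_eq fin_numD !fin_num_measure.
have [mu muE] := finite_measure_of nuT.
exists mu => f i1 i2; have mf := measurable_int _ i1.
have E (h : R -> \bar R) : (\int[mu]_x h x = \int[nu]_x h x)%E.
  by apply: eq_measure_integral => A _ _; exact: muE.
split; last by rewrite E integral_measure_add.
apply/integrableP; split => //; rewrite E ge0_integral_measure_add//; last first.
  exact: measurableT_comp.
by move/integrableP : i1 => [_ h1]; move/integrableP : i2 => [_ h2];
  exact: lte_add_pinfty.
Qed.

(** Real-valued integrals, so that the bookkeeping of the exchange is plain linear arithmetic. *)
Definition fint eta (D : set R) (f : R -> \bar R) : R :=
  fine (\int[eta]_(x in D) f x).

Lemma fintK eta (D : set R) (f : R -> \bar R) : measurable D ->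
  eta.-integrable setT f -> (fint eta D f)%:E = (\int[eta]_(x in D) f x)%E.
Proof.
move=> mD fi; rewrite /fint fineK//; apply: integrable_fin_num => //.
exact: integrableS fi.
Qed.

Lemma fintU eta (A B : set R) (f : R -> \bar R) : measurable A -> measurable B ->
  A `&` B = set0 -> eta.-integrable setT f ->
  fint eta (A `|` B) f = fint eta A f + fint eta B f.
Proof.
move=> mA mB AB fi; apply: EFin_inj; rewrite EFinD !fintK//; last first.
  exact: measurableU.
rewrite integral_setU//.
  by apply: measurable_funTS; exact: measurable_int fi.
by apply/disj_setPS; rewrite AB.
Qed.

(** No measure is subtracted: removing the fraction [s] of [eta] on [L] means keeping [1 - s] of it.
    Each new fiber is a sum of four nonnegative multiples of restrictions of [eta] and [theta]. *)
Lemma exchange_measures eta theta (L S M : set R) (s t u : R) :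
  measurable L -> measurable S -> measurable M -> L `&` S = set0 ->
  0 <= s <= 1 -> 0 <= t <= 1 -> 0 <= u <= 1 ->
  exists mu mu', forall f : R -> \bar R,
    eta.-integrable setT f -> theta.-integrable setT f ->
    [/\ mu.-integrable setT f, mu'.-integrable setT f,
        fint mu setT f = fint eta setT f - (s * fint eta L f + t * fint eta S f)
          + u * fint theta M f &
        fint mu' setT f = fint theta setT f
          + (s * fint eta L f + t * fint eta S f) - u * fint theta M f].
Proof.
move=> mL mS mM LS /andP[s0 s1] /andP[t0 t1] /andP[u0 u1].
have mLS : measurable (L `|` S) by exact: measurableU.
have mO := measurableC mLS; have mMC := measurableC mM.
have s'0 : 0 <= 1 - s by rewrite subr_ge0.
have t'0 : 0 <= 1 - t by rewrite subr_ge0.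
have u'0 : 0 <= 1 - u by rewrite subr_ge0.
have [l1 l1E] := scaled_part_exists eta s'0 mL.
have [r1 r1E] := scaled_part_exists eta t'0 mS.
have [oo1 o1E] := scaled_part_exists eta ler01 mO.
have [m1 m1E] := scaled_part_exists theta u0 mM.
have [l2 l2E] := scaled_part_exists eta s0 mL.
have [r2 r2E] := scaled_part_exists eta t0 mS.
have [oo2 o2E] := scaled_part_exists theta ler01 mMC.
have [m2 m2E] := scaled_part_exists theta u'0 mM.
have [a1 a1E] := sum_measure_exists l1 r1.
have [b1 b1E] := sum_measure_exists oo1 m1.
have [mu muE] := sum_measure_exists a1 b1.
have [a2 a2E] := sum_measure_exists l2 r2.
have [b2 b2E] := sum_measure_exists oo2 m2.
have [mu' mu'E] := sum_measure_exists a2 b2.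
exists mu, mu' => f fe ft.
have [il1 el1] := l1E f fe; have [ir1 er1] := r1E f fe.
have [io1 eo1] := o1E f fe; have [imm1 em1] := m1E f ft.
have [il2 el2] := l2E f fe; have [ir2 er2] := r2E f fe.
have [io2 eo2] := o2E f ft; have [im2 em2] := m2E f ft.
have [ia1 ea1] := a1E f il1 ir1; have [ib1 eb1] := b1E f io1 imm1.
have [imu emu] := muE f ia1 ib1.
have [ia2 ea2] := a2E f il2 ir2; have [ib2 eb2] := b2E f io2 im2.
have [imu' emu'] := mu'E f ia2 ib2.
have eT : fint eta setT f =
    fint eta L f + fint eta S f + fint eta (~` (L `|` S)) f.
  rewrite -[in LHS](setUv (L `|` S)) fintU ?setICr//.
  by rewrite fintU.
have thT : fint theta setT f = fint theta M f + fint theta (~` M) f.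
  by rewrite -[in LHS](setUv M) fintU ?setICr.
split => //.
- apply: EFin_inj; rewrite fintK// emu ea1 eb1 el1 er1 eo1 em1.
  rewrite -!fintK// -!EFinM -!EFinD; congr EFin; rewrite eT; ring.
- apply: EFin_inj; rewrite fintK// emu' ea2 eb2 el2 er2 eo2 em2.
  rewrite -!fintK// -!EFinM -!EFinD; congr EFin; rewrite thT; ring.
Qed.

Lemma fint_indic eta (D B : set R) : measurable D -> measurable B ->
  fint eta D (EFin \o \1_B) = fine (eta (B `&` D)).
Proof. by move=> mD mB; rewrite /fint integral_indic. Qed.

End exchange.

(** Two homogeneous equations in three unknowns, solved by a cross product. With moments taken about
    [y], the rows are [(mL, mS, - mM)] and [(- A, B, - X)]. The moments of the outer bits dominate
    that of the middle one, which gives the signs; dividing by the sum [w] brings the weights below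
    [1]. *)
Lemma exchange_weights (R : realType) (y d mL mS mM eL eS eM : R) :
  0 < d -> 0 < mL -> 0 < mS -> 0 < mM ->
  eL <= (y - 3 * d) * mL -> (y + 3 * d) * mS <= eS ->
  (y - d) * mM <= eM -> eM <= (y + d) * mM ->
  exists s t u : R, [/\ 0 <= s <= 1, 0 <= t <= 1, 0 < u <= 1,
    s * mL + t * mS = u * mM & s * eL + t * eS = u * eM].
Proof.
move=> d0 L0 S0 M0 hL hS hM1 hM2.
pose A := y * mL - eL; pose B := eS - y * mS; pose X := eM - y * mM.
have dL : 0 < d * mL by exact: mulr_gt0.
have dS : 0 < d * mS by exact: mulr_gt0.
have hA : 3 * (d * mL) <= A by rewrite /A; lra.
have hB : 3 * (d * mS) <= B by rewrite /B; lra.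
have X1 : X <= d * mM by rewrite /X; lra.
have X2 : - (d * mM) <= X by rewrite /X; lra.
pose s0 := mM * B - mS * X; pose t0 := mM * A + mL * X.
pose u0 := mL * B + mS * A.
have MB := ler_wpM2l (ltW M0) hB; have MA := ler_wpM2l (ltW M0) hA.
have SX := ler_wpM2l (ltW S0) X1; have LX := ler_wpM2l (ltW L0) X2.
have MS := mulr_gt0 M0 dS; have ML := mulr_gt0 M0 dL.
have s00 : 0 <= s0 by rewrite /s0; lra.
have t00 : 0 <= t0 by rewrite /t0; lra.
have u00 : 0 < u0.
  by rewrite /u0; apply: addr_gt0; apply: mulr_gt0 => //; lra.
pose w := s0 + t0 + u0.
have w0 : 0 < w by rewrite /w; lra.
have wn0 : w != 0 by rewrite gt_eqF.
exists (s0 / w), (t0 / w), (u0 / w); split.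
- by apply/andP; split; [apply: divr_ge0; lra|rewrite ler_pdivrMr// /w; lra].
- by apply/andP; split; [apply: divr_ge0; lra|rewrite ler_pdivrMr// /w; lra].
- by apply/andP; split; [exact: divr_gt0|rewrite ler_pdivrMr// /w; lra].
- apply: (mulfI wn0); rewrite /s0 /t0 /u0 /A /B /X; field.
  by move: wn0; rewrite /w /s0 /t0 /u0 /A /B /X.
- apply: (mulfI wn0); rewrite /s0 /t0 /u0 /A /B /X; field.
  by move: wn0; rewrite /w /s0 /t0 /u0 /A /B /X.
Qed.

Section chord.
Context (R : realType) (I : set R) (f : R -> R).
Hypothesis iI : is_interval I.
Hypothesis cf : strictly_concave_on I f.

(* The chord of [f] through [y - 2 d] and [y + 2 d]: on the middle half of that
   interval the gap between [f] and the chord is at least half the gap at [y]. *)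
Lemma concave_chord (y d : R) : 0 < d -> I (y - 2 * d) -> I (y + 2 * d) ->
  exists a b e : R, [/\ 0 < e,
    forall z, y - d < z < y + d -> a + b * z + e <= f z,
    forall z, I z -> z < y - 2 * d -> f z <= a + b * z &
    forall z, I z -> y + 2 * d < z -> f z <= a + b * z].
Proof.
move=> d0 Ic Id.
pose c := y - 2 * d; pose c' := y + 2 * d.
have Iin z : c <= z -> z <= c' -> I z.
  by move=> h1 h2; apply: (iI Ic Id); rewrite h1.
have cc := strictly_concave_concave cf.
have d4 : 0 < 4 * d by lra.
pose b := (f c' - f c) / (4 * d).
have bE : b * (4 * d) = f c' - f c by rewrite /b divfK// gt_eqF.
pose a := f c - b * c.
have hc : f c = a + b * c by rewrite /a; ring.
have hc' : f c' = a + b * c'.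
  have -> : c' = c + 4 * d by rewrite /c' /c; ring.
  rewrite mulrDr addrA -hc bE; have -> : c + 4 * d = c' by rewrite /c' /c; ring.
  ring.
pose gap := f y - (a + b * y).
have fy : f y = a + b * y + gap by rewrite /gap; ring.
have cy : c < y by rewrite /c; lra.
have yc' : y < c' by rewrite /c'; lra.
have Iy : I y by apply: Iin; exact: ltW.
have gap0 : 0 < gap.
  have := strictly_concave3 cf Ic Id cy yc'.
  rewrite -/c -/c' hc hc' fy -subr_gt0.
  rewrite (_ : _ - _ = 4 * d * gap); first by rewrite pmulr_rgt0.
  by rewrite /c /c'; ring.
exists a, b, (gap / 2); split; first lra.
- move=> z /andP[z1 z2].
  have [zy|yz|->] := ltgtP z y; last by lra.
  + have cz : c < z by rewrite /c; lra.
    have Iz : I z by apply: Iin; rewrite ltW// (lt_trans zy).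
    have := cc c z y Ic Iz Iy cz zy; rewrite hc fy => h.
    have zg : d * gap <= (z - c) * gap by apply: ler_wpM2r; rewrite /c; lra.
    have d2 : 0 < 2 * d by lra.
    rewrite -(ler_pM2l d2).
    have -> : 2 * d * (a + b * z + gap / 2) = 2 * d * (a + b * z) + d * gap.
      by field.
    apply: (@le_trans _ _ ((y - c) * f z)); last by rewrite /c; lra.
    apply: le_trans h.
    apply: (@le_trans _ _ (2 * d * (a + b * z) + (z - c) * gap)).
      by rewrite lerD2l.
    by rewrite le_eqVlt; apply/orP; left; apply/eqP; rewrite /c; ring.
  + have zc : z < c' by rewrite /c'; lra.
    have Iz : I z by apply: Iin; rewrite ltW// (lt_trans cy).
    have := cc y z c' Iy Iz Id yz zc; rewrite hc' fy => h.
    have zg : d * gap <= (c' - z) * gap by apply: ler_wpM2r; rewrite /c'; lra.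
    have d2 : 0 < 2 * d by lra.
    rewrite -(ler_pM2l d2).
    have -> : 2 * d * (a + b * z + gap / 2) = 2 * d * (a + b * z) + d * gap.
      by field.
    apply: (@le_trans _ _ ((c' - y) * f z)); last by rewrite /c'; lra.
    apply: le_trans h.
    apply: (@le_trans _ _ (2 * d * (a + b * z) + (c' - z) * gap)).
      by rewrite lerD2l.
    by rewrite le_eqVlt; apply/orP; left; apply/eqP; rewrite /c'; ring.
- move=> z Iz zc; have cc' : c < c' by exact: lt_trans yc'.
  have := cc z c c' Iz Ic Id zc cc'; rewrite hc hc' => h.
  rewrite -(ler_pM2l d4) -subr_ge0.
  move: h; rewrite -subr_ge0; congr (_ <= _); rewrite /c /c'; ring.
- move=> z Iz zc; have cc' : c < c' by exact: lt_trans yc'.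
  have := cc c c' z Ic Id Iz cc' zc; rewrite hc hc' => h.
  rewrite -(ler_pM2l d4) -subr_ge0.
  move: h; rewrite -subr_ge0; congr (_ <= _); rewrite /c /c'; ring.
Qed.

End chord.

(** * Maximizers are nested *)

Lemma open_has_larger (R : realType) (I : set R) (p : R) : open I -> I p ->
  exists a b, [/\ I a, I b, a < p & p < b].
Proof.
move=> oI Ip.
have /nbhs_ballP[e /= e0] : nbhs p I by exact: open_nbhs_nbhs.
rewrite ball_itv => be.
by exists (p - e / 2), (p + e / 2); split; (try lra);
  apply: be => /=; rewrite in_itv/=; apply/andP; split; lra.
Qed.

(** The positive part of [f] is bounded by that of an affine supergradient, integrable as [mu] has a
    mean; the negative part is integrable by assumption. *)
Lemma concave_integrable (R : realType) (I : set R)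
    (mu : {finite_measure set R -> \bar R}) (f : R -> R) :
  I !=set0 -> open I -> is_interval I -> finite_mean mu ->
  concave_on I f -> (\int[mu]_(y in I) ((EFin \o f)^\- y) < +oo)%E ->
  mu.-integrable I (EFin \o f).
Proof.
move=> [p Ip] oI iI mean cf fneg.
have mI : measurable I by exact: open_measurable.
have mf : measurable_fun I f by exact: concave_measurable.
have mEf : measurable_fun I (EFin \o f) by exact/measurable_EFinP.
have [a [b [Ia Ib ap pb]]] := open_has_larger oI Ip.
have [s fs] := concave_supergradient iI cf Ia Ib ap pb.
have ineg : mu.-integrable I ((EFin \o f)^\-)%E.
  apply/integrableP; split; first exact: measurable_funeneg.
  by under eq_integral do rewrite gee0_abs//.
have iid : mu.-integrable I (fun y : R => y%:E).
  by apply: integrableS mean.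
have iaff : mu.-integrable I (fun y : R => (f p + s * (y - p))%:E).
  apply: (@eq_integrable _ _ _ mu I mI
    (fun y : R => (f p - s * p)%:E + s%:E * y%:E)%E) => //.
    by move=> y _; rewrite -EFinM -EFinD; congr EFin; ring.
  apply: integrableD => //; first exact: finite_measure_integrable_cst.
  exact: integrableZl.
have isum := integrableD mI (integrable_funepos mI iaff) ineg.
apply: (@le_integrable _ _ _ mu I mI _ _ mEf _ isum) => y Iy.
rewrite [leRHS]gee0_abs; last exact: adde_ge0.
have -> : (`|(EFin \o f) y| = (EFin \o f)^\+ y + (EFin \o f)^\- y)%E.
  have /(congr1 (fun h => h y)) := fune_abse (EFin \o f); exact.
apply: leeD2r; rewrite !funeposE /= -!EFin_max lee_fin.
by rewrite ge_max !le_max lexx orbT andbT fs.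
Qed.

Section maximizer.
Context (R : realType) (I : set R) (lambda1 lambda2 : probability R R).
Hypothesis I0 : I !=set0.
Hypothesis oI : open I.
Hypothesis iI : is_interval I.
Hypothesis lambda1_I : carried_by lambda1 I.
Hypothesis lambda2_mean : finite_mean lambda2.
Context (n : nat) (J : 'I_n -> R).
Hypothesis bijJ : set_bij [set: 'I_n] (support_in I lambda1) J.

Let mI : measurable I. Proof. exact: open_measurable. Qed.

Lemma integral_transport (nu : {measure set (R * R) -> \bar R})
    (eta : 'I_n -> {finite_measure set R -> \bar R}) (f g : R -> R) :
  transport_family I lambda1 lambda2 J eta -> fibered J nu eta ->
  measurable_fun I g -> lambda2.-integrable I (EFin \o f) ->
  (\int[nu]_(z in I `*` I) (tensor g f z)%:E =
   (\sum_(i < n) g (J i) * fint (eta i) setT ((EFin \o f) \_ I)%E)%:E)%E.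
Proof.
move=> fam nuE mg intf.
have mf : measurable_fun I f by apply/measurable_EFinP; exact: measurable_int intf.
have ii i : (eta i).-integrable I (EFin \o f).
  exact: family_integrable fam intf.
rewrite (integral_tensor nuE mI (atoms_in bijJ) mg mf ii).
rewrite -sumEFin; apply: eq_bigr => i _; rewrite EFinM fintK//.
  by rewrite -integral_mkcond.
by apply: (proj1 (integrable_mkcond _ mI)); exact: ii.
Qed.

Lemma family_exchange (eta : 'I_n -> {finite_measure set R -> \bar R})
    (i j : 'I_n) (mu mu' : {finite_measure set R -> \bar R}) :
  i != j -> transport_family I lambda1 lambda2 J eta ->
  mu (~` I) = 0%E -> mu' (~` I) = 0%E ->
  mu setT = eta i setT -> mu' setT = eta j setT ->
  (forall B, measurable B -> (mu B + mu' B = eta i B + eta j B)%E) ->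
  (\int[mu]_y y%:E = \int[eta i]_y y%:E)%E ->
  (\int[mu']_y y%:E = \int[eta j]_y y%:E)%E ->
  transport_family I lambda1 lambda2 J
    (fun k => if k == i then mu else if k == j then mu' else eta k).
Proof.
move=> ij [etaI mass marg mean] I1 I2 T1 T2 sumE e1 e2; split.
- by move=> k; case: eqP => // _; case: eqP.
- move=> k; case: eqP => [->|_]; first by rewrite T1; exact: mass.
  by case: eqP => [->|_]; [rewrite T2|]; exact: mass.
- move=> B mB; rewrite marg// (bigD1 i)//= (bigD1 j) ?(eq_sym j)//=.
  rewrite [RHS](bigD1 i)//= [in RHS](bigD1 j) ?(eq_sym j)//=.
  have ji : (j == i) = false by rewrite eq_sym (negbTE ij).
  rewrite !eqxx ?ji ?(negbTE ij) !addeA -sumE//; congr (_ + _)%E.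
  by apply: eq_bigr => k /andP[/negbTE -> /negbTE ->].
- move=> k; case: eqP => [->|_]; first by rewrite e1 mean.
  by case: eqP => [->|_]; [rewrite e2|]; rewrite mean.
Qed.

Lemma nested_of_maximizer (nu : {measure set (R * R) -> \bar R})
    (eta : 'I_n -> {finite_measure set R -> \bar R}) (f g : R -> R) :
  strictly_concave_on I f -> measurable_fun I g ->
  lambda2.-integrable I (EFin \o f) ->
  maximizing_transport I lambda1 lambda2 (tensor g f) nu ->
  transport_family I lambda1 lambda2 J eta -> fibered J nu eta ->
  (forall i j : 'I_n, (i < j)%N -> g (J j) < g (J i)) ->
  nested eta.
Proof.
move=> cf mg intf [_ maxi] fam nuE gJ i j ij.
have [etaI mass marg mean] := fam.
(* [f] is cut off outside [I], as the exchange works with functions integrable on the whole line. *)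
pose h : R -> \bar R := ((EFin \o f) \_ I)%E.
have inth2 : lambda2.-integrable setT h by apply: (proj1 (integrable_mkcond _ mI)).
have famint (F : R -> \bar R) k : lambda2.-integrable setT F ->
    (eta k).-integrable setT F by exact: family_integrable fam.
apply: contrapT => /eqP nz.
have [y Cy posy] := point_of_non_null (measurable_inner_hull (eta i)) nz.
have [Cy1 Cy2] := Cy.
have mray1 : measurable (`]-oo, y[%classic : set R) by [].
have mray2 : measurable (`]y, +oo[%classic : set R) by [].
have [y1 [y1y Iy1] pos1] : exists2 z, (`]-oo, y[%classic `&` I) z &
    forall U : set R, open U -> U z -> (0 < eta i U)%E.
  apply: point_of_non_null; first exact: measurableI.
  by rewrite (setTC_carried mI mray1 (etaI i)) gt_eqF.
have [y2 [y2y Iy2] pos2] : exists2 z, (`]y, +oo[%classic `&` I) z &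
    forall U : set R, open U -> U z -> (0 < eta i U)%E.
  apply: point_of_non_null; first exact: measurableI.
  by rewrite (setTC_carried mI mray2 (etaI i)) gt_eqF.
rewrite /= in_itv/= in y1y; rewrite /= in_itv/= andbT in y2y.
(* With this [d], the balls of radius [d] about [y1] and [y2] lie beyond [y - 3 * d] and
   [y + 3 * d]. The chord through [y - 2 * d] and [y + 2 * d] is thus above [f] on both of them, and
   below [f] on the ball about [y]. *)
have [d [d0 d1 d2]] : exists d, [/\ 0 < d, 4 * d <= y - y1 & 4 * d <= y2 - y].
  exists (Num.min (y - y1) (y2 - y) / 4); split.
  - by rewrite divr_gt0// lt_min !subr_gt0 y1y.
  - by rewrite mulrC divfK// ge_min lexx.
  - by rewrite mulrC divfK// ge_min lexx orbT.
have Iin z : y1 <= z -> z <= y2 -> I z.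
  by move=> z1 z2; apply: (iI Iy1 Iy2); rewrite z1.
have [a [b [e [e0 midE lowE uppE]]]] := concave_chord iI cf d0
  (Iin (y - 2 * d) ltac:(lra) ltac:(lra)) (Iin (y + 2 * d) ltac:(lra) ltac:(lra)).
pose ball_ z := `]z - d, z + d[%classic : set R.
have oball z : open (ball_ z) by exact: interval_open.
have inball z : ball_ z z by rewrite /ball_/= in_itv/=; apply/andP; split; lra.
pose L := ball_ y1 `&` I; pose S := ball_ y2 `&` I; pose M := ball_ y `&` I.
have mL : measurable L by apply: measurableI => //; exact: open_measurable.
have mS : measurable S by apply: measurableI => //; exact: open_measurable.
have mM : measurable M by apply: measurableI => //; exact: open_measurable.
have posI k z : (forall U : set R, open U -> U z -> (0 < eta k U)%E) ->
    0 < fine (eta k (ball_ z `&` I)).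
  move=> pz; have mb : measurable (ball_ z) by exact: open_measurable.
  rewrite (setTC_carried mI mb (etaI k)) fine_gt0// pz//=.
  by rewrite ltey_eq fin_num_measure.
have L0 := posI i y1 pos1; have S0 := posI i y2 pos2; have M0 := posI j y posy.
have LS : L `&` S = set0.
  apply/seteqP; split => // z [[+ _] [+ _]]; rewrite /ball_/= !in_itv/=.
  move=> /andP[_ z1] /andP[z2 _]; have : z < z by lra.
  by rewrite ltxx.
have int1 : lambda2.-integrable setT (EFin \o (fun _ : R => 1)).
  exact: (finite_measure_integrable_cst lambda2 1 measurableT).
have intid : lambda2.-integrable setT (EFin \o (fun y : R => y)).
  exact: lambda2_mean.
have intaff (p q : R) : lambda2.-integrable setT (EFin \o (fun z : R => p + q * z)).
  apply: (@eq_integrable _ _ _ lambda2 setT measurableT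
    (fun y : R => p%:E + q%:E * y%:E)%E) => //.
  apply: integrableD => //; first exact: finite_measure_integrable_cst.
  exact: integrableZl.
pose m k (D : set R) := fine (eta k D).
pose id_ : R -> \bar R := EFin \o (fun z : R => z).
have fint_aff k (D : set R) p q : measurable D ->
    fint (eta k) D (EFin \o (fun z : R => p + q * z)) =
    p * m k D + q * fint (eta k) D id_.
  move=> mD; apply: EFin_inj; rewrite fintK//; last exact: famint.
  rewrite (eq_integral (fun z : R => p%:E + q%:E * id_ z)%E) => [|z _ //].
  rewrite integralD//; last 2 first.
    exact: finite_measure_integrable_cst.
    by apply: integrableZl => //; apply: integrableS (famint _ _ intid).
  rewrite integral_cst// integralZl//; last first.
    by apply: integrableS (famint _ _ intid).
  rewrite EFinD !EFinM (fintK mD (famint _ _ intid)).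
  by rewrite (_ : (m k D)%:E = eta k D)// fineK// fin_num_measure.
have fint_le k (D : set R) (u v : R -> \bar R) : measurable D ->
    lambda2.-integrable setT u -> lambda2.-integrable setT v ->
    (forall z : R, D z -> (u z <= v z)%E) -> fint (eta k) D u <= fint (eta k) D v.
  move=> mD iu iv uv; rewrite -lee_fin !fintK//; try exact: famint.
  apply: le_integral => //; [exact: integrableS (famint _ _ iu)|
    exact: integrableS (famint _ _ iv)|by move=> z; rewrite inE; exact: uv].
have hE z : I z -> h z = (f z)%:E by move=> Iz; rewrite /h patchE mem_set.
have affE k (D : set R) p : measurable D ->
    fint (eta k) D (EFin \o (fun z : R => p + 0 * z)) = p * m k D.
  by move=> mD; rewrite fint_aff// mul0r addr0.
have id_le k (D : set R) p : measurable D -> (forall z : R, D z -> z <= p) ->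
    fint (eta k) D id_ <= p * m k D.
  move=> mD Dp; rewrite -affE//; apply: fint_le => // z Dz.
  by rewrite /= lee_fin mul0r addr0; exact: Dp.
have id_ge k (D : set R) p : measurable D -> (forall z : R, D z -> p <= z) ->
    p * m k D <= fint (eta k) D id_.
  move=> mD Dp; rewrite -affE//; apply: fint_le => // z Dz.
  by rewrite /= lee_fin mul0r addr0; exact: Dp.
have eL : fint (eta i) L id_ <= (y - 3 * d) * m i L.
  by apply: id_le => // z [+ _]; rewrite /ball_/= in_itv/= => /andP[? ?]; lra.
have eS : (y + 3 * d) * m i S <= fint (eta i) S id_.
  by apply: id_ge => // z [+ _]; rewrite /ball_/= in_itv/= => /andP[? ?]; lra.
have eM1 : (y - d) * m j M <= fint (eta j) M id_.
  by apply: id_ge => // z [+ _]; rewrite /ball_/= in_itv/= => /andP[? ?]; lra.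
have eM2 : fint (eta j) M id_ <= (y + d) * m j M.
  by apply: id_le => // z [+ _]; rewrite /ball_/= in_itv/= => /andP[? ?]; lra.
have [s [t [u [s01 t01 /andP[u0 u1] massE meanE]]]] :=
  exchange_weights d0 L0 S0 M0 eL eS eM1 eM2.
have u01 : 0 <= u <= 1 by rewrite ltW.
have [mu [mu' muE]] := exchange_measures (eta i) (eta j) mL mS mM LS s01 t01 u01.
have hL : fint (eta i) L h <= a * m i L + b * fint (eta i) L id_.
  rewrite -fint_aff//; apply: fint_le => // z [+ Iz]; rewrite hE//= lee_fin.
  by rewrite /ball_/= in_itv/= => /andP[? ?]; apply: lowE => //; lra.
have hS : fint (eta i) S h <= a * m i S + b * fint (eta i) S id_.
  rewrite -fint_aff//; apply: fint_le => // z [+ Iz]; rewrite hE//= lee_fin.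
  by rewrite /ball_/= in_itv/= => /andP[? ?]; apply: uppE => //; lra.
have hM : (a + e) * m j M + b * fint (eta j) M id_ <= fint (eta j) M h.
  rewrite -fint_aff//; apply: fint_le => // z [+ Iz]; rewrite hE//= lee_fin.
  by rewrite /ball_/= in_itv/= => zd; have := midE z zd; lra.
(* The bits exchanged have equal mass and mean, so the chord contributes equally to both sides; the
   gap [e] over [M] remains. *)
have gain : s * fint (eta i) L h + t * fint (eta i) S h < u * fint (eta j) M h.
  have /andP[s0 _] := s01; have /andP[t0 _] := t01.
  have k1 := ler_wpM2l s0 hL; have k2 := ler_wpM2l t0 hS.
  have k3 := ler_wpM2l (ltW u0) hM.
  have k4 : 0 < u * (e * m j M) by rewrite mulr_gt0// mulr_gt0.
  have k5 : a * (s * m i L + t * m i S) = a * (u * m j M) by rewrite /m massE.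
  have k6 : b * (s * fint (eta i) L id_ + t * fint (eta i) S id_) =
    b * (u * fint (eta j) M id_) by rewrite meanE.
  lra.
(* Indicators turn the integral description of [mu] and [mu'] into their values on sets. *)
have intind B : measurable B -> lambda2.-integrable setT (EFin \o \1_B : R -> \bar R).
  by move=> mB; exact: integrable_indic.
have muB (B : set R) : measurable B ->
    fine (mu B) = m i B - (s * m i (B `&` L) + t * m i (B `&` S))
      + u * m j (B `&` M) /\
    fine (mu' B) = m j B + (s * m i (B `&` L) + t * m i (B `&` S))
      - u * m j (B `&` M).
  move=> mB.
  have [_ _] := muE _ (famint _ i (intind _ mB)) (famint _ j (intind _ mB)).
  by rewrite !fint_indic// !setIT.
have fineE (z : {finite_measure set R -> \bar R}) (B : set R) : measurable B ->
    z B = (fine (z B))%:E.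
  by move=> mB; rewrite fineK// fin_num_measure.
have mCI := measurableC mI.
have offI (B : set R) k : B `<=` I -> m k (~` I `&` B) = 0.
  move=> BI; rewrite (_ : _ `&` _ = set0) ?/m ?measure0//.
  by apply/seteqP; split => // z [nIz /BI].
have mCI0 k : m k (~` I) = 0 by rewrite /m (etaI k).
have [LI SI MI] : [/\ L `<=` I, S `<=` I & M `<=` I] by split => z [].
have [muI mu'I] : mu (~` I) = 0%E /\ mu' (~` I) = 0%E.
  have [E1 E2] := muB _ mCI.
  rewrite (fineE mu)// (fineE mu')// E1 E2 !mCI0 !offI//.
  by split; congr EFin; ring.
have [muT mu'T] : mu setT = eta i setT /\ mu' setT = eta j setT.
  have [E1 E2] := muB _ measurableT; rewrite !setTI in E1 E2.
  rewrite (fineE mu)// (fineE mu')// (fineE (eta i))// (fineE (eta j))//.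
  split; congr EFin; [rewrite E1|rewrite E2]; rewrite /m massE; ring.
have sumB (B : set R) : measurable B -> (mu B + mu' B = eta i B + eta j B)%E.
  move=> mB; have [E1 E2] := muB _ mB.
  rewrite (fineE mu)// (fineE mu')// (fineE (eta i))// (fineE (eta j))//.
  by rewrite -!EFinD E1 E2 /m; congr EFin; ring.
have [imu imu' mean1 mean2] := muE _ (famint _ i intid) (famint _ j intid).
have nij : i != j by rewrite -val_eqE/= ltn_eqF.
have meanmu : (\int[mu]_y y%:E = \int[eta i]_y y%:E)%E.
  rewrite -[LHS](fintK measurableT imu) -[RHS](fintK measurableT (famint _ i intid)).
  by congr EFin; rewrite mean1 -/id_ meanE; ring.
have meanmu' : (\int[mu']_y y%:E = \int[eta j]_y y%:E)%E.
  rewrite -[LHS](fintK measurableT imu') -[RHS](fintK measurableT (famint _ j intid)).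
  by congr EFin; rewrite mean2 -/id_ meanE; ring.
have fam' := family_exchange nij fam muI mu'I muT mu'T sumB meanmu meanmu'.
have [rho rhoE] := fibered_measure_exists J
  (fun k => if k == i then mu else if k == j then mu' else eta k).
have mart := coupling_of_fibers oI lambda1_I bijJ lambda2_mean fam' rhoE.
have := maxi rho mart.
rewrite (integral_transport fam' rhoE mg intf).
rewrite (integral_transport fam nuE mg intf).
rewrite lee_fin leNgt => /negP; apply.
have [_ _ h1 h2] := muE h (famint _ i inth2) (famint _ j inth2).
rewrite (bigD1 i)//= (bigD1 j) ?(eq_sym j)//=.
rewrite [ltRHS](bigD1 i)//= [in ltRHS](bigD1 j) ?(eq_sym j)//=.
have ji : (j == i) = false by rewrite eq_sym (negbTE nij).
rewrite !eqxx ?ji ?(negbTE nij) !addrA.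
rewrite [X in _ < _ + X](eq_bigr (fun k => g (J k) * fint (eta k) setT h)); last first.
  by move=> k /andP[/negbTE -> /negbTE ->].
rewrite ltrD2r h1 h2 -/h -subr_gt0.
(* What fiber [i] gains fiber [j] loses, so the objective grows by the product of the two positive
   numbers [gg] and [gn]. *)
have gg : 0 < g (J i) - g (J j) by rewrite subr_gt0 gJ.
have gn : 0 < u * fint (eta j) M h - (s * fint (eta i) L h + t * fint (eta i) S h).
  by rewrite subr_gt0.
move: (mulr_gt0 gg gn); congr (_ < _); ring.
Qed.

End maximizer.

(** * The equivalences *)

Section hyperbola.
Context (R : realType).

(** Strictly concave and Lipschitz, so one choice serves every [I] and every [lambda2] with a
    mean. *)
Definition hyperbola (y : R) : R := - Num.sqrt (1 + y ^+ 2).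

Let sq_ge0 (y : R) : 0 <= 1 + y ^+ 2.
Proof. by rewrite addr_ge0// sqr_ge0. Qed.

(** Up to sign this is the Euclidean norm of [(1, y)]. Strictness comes from the Cauchy-Schwarz
    inequality for [(1, x)] and [(1, z)], whose defect after squaring is [(x - z) ^+ 2]. *)
Lemma hyperbola_strictly_concave (I : set R) : strictly_concave_on I hyperbola.
Proof.
move=> x z t _ _ xz /andP[t0 t1]; rewrite /hyperbola.
set a := Num.sqrt (1 + x ^+ 2); set b := Num.sqrt (1 + z ^+ 2).
have a2 : a ^+ 2 = 1 + x ^+ 2 by rewrite sqr_sqrtr.
have b2 : b ^+ 2 = 1 + z ^+ 2 by rewrite sqr_sqrtr.
have a0 : 0 <= a by exact: sqrtr_ge0.
have b0 : 0 <= b by exact: sqrtr_ge0.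
have ab : 1 + x * z < a * b.
  have [neg|pos] := ltP (1 + x * z) 0; first by rewrite (lt_le_trans neg)// mulr_ge0.
  rewrite -(ltr_pXn2r (n := 2))// ?nnegrE ?mulr_ge0// exprMn a2 b2 -subr_gt0.
  rewrite (_ : _ - _ = (x - z) ^+ 2); last by ring.
  by rewrite exprn_even_gt0//= subr_eq0; apply/eqP.
have s0 : 0 <= t * a + (1 - t) * b.
  by rewrite addr_ge0// mulr_ge0// ?subr_ge0 ltW.
rewrite !mulrN -opprD ltrN2 -(ltr_pXn2r (n := 2))// ?nnegrE ?sqrtr_ge0//.
rewrite sqr_sqrtr// -subr_gt0.
have -> : (t * a + (1 - t) * b) ^+ 2 - (1 + (t * x + (1 - t) * z) ^+ 2) =
    t ^+ 2 * (a ^+ 2) + (1 - t) ^+ 2 * (b ^+ 2) + 2 * t * (1 - t) * (a * b)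
    - (1 + (t * x + (1 - t) * z) ^+ 2) by ring.
rewrite a2 b2 (_ : _ - _ = 2 * t * (1 - t) * (a * b - (1 + x * z))); last by ring.
by rewrite !mulr_gt0// subr_gt0.
Qed.

Lemma hyperbola_concave (I : set R) : concave_on I hyperbola.
Proof. by apply: strictly_concave_concave; exact: hyperbola_strictly_concave. Qed.

Lemma hyperbola_slope_bounded : slope_bounded hyperbola.
Proof.
exists 1 => // x y; rewrite /hyperbola mul1r.
suff : Num.sqrt (1 + y ^+ 2) <= Num.sqrt (1 + x ^+ 2) + `|x - y| by lra.
set a := Num.sqrt (1 + x ^+ 2).
have a0 : 0 <= a by exact: sqrtr_ge0.
have a2 : a ^+ 2 = 1 + x ^+ 2 by rewrite sqr_sqrtr.
have xa : `|x| <= a by rewrite -sqrtr_sqr ler_sqrt// lerDr.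
have n0 : 0 <= a + `|x - y| by rewrite addr_ge0.
rewrite -(ger0_norm n0) -sqrtr_sqr ler_sqrt ?sqr_ge0//.
have d2 : `|x - y| ^+ 2 = (x - y) ^+ 2 by rewrite real_normK// num_real.
have h1 : `|x| * `|x - y| <= a * `|x - y| by rewrite ler_wpM2r.
have h2 : x * (y - x) <= `|x| * `|x - y|.
  by rewrite -normrM (le_trans (ler_norm _))// !normrM (distrC y x).
rewrite sqrrD a2 d2 mulr2n; nra.
Qed.

Lemma hyperbola_measurable (D : set R) : measurable_fun D hyperbola.
Proof.
by apply: measurable_funTS; apply: concave_measurable => //; exact: hyperbola_concave.
Qed.

End hyperbola.

Section ranking.
Context (R : realType) (n : nat) (J : 'I_n -> R).
Hypothesis injJ : injective J.

(** A simple function, hence Borel and bounded, that takes the value [- i] at [J i]: injective on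
    the atoms and decreasing along [J]. *)
Definition ranking (x : R) : R := - \sum_(i < n) i%:R * \1_[set J i] x.

Lemma ranking_atom i : ranking (J i) = - i%:R.
Proof.
rewrite /ranking (bigD1 i)//= indicE mem_set// mulr1 big1 ?addr0// => j ji.
by rewrite indicE memNset ?mulr0// => /= /injJ/eqP; rewrite eq_sym (negbTE ji).
Qed.

Lemma ranking_measurable (D : set R) : measurable_fun D ranking.
Proof.
apply: measurable_funTS; apply: measurableT_comp => //.
by apply: measurable_sum => i; exact: measurable_funM.
Qed.

Lemma ranking_bounded (D : set R) : [bounded ranking x | x in D].
Proof.
exists (\sum_(i < n) i%:R); split; first exact: num_real.
move=> M /ltW sM x _; apply: le_trans sM; rewrite /ranking normrN.
apply: le_trans (ler_norm_sum _ _ _) _; apply: ler_sum => i _.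
rewrite normrM ger0_norm// indicE; case: (_ \in _); rewrite ?normr1 ?mulr1//.
by rewrite normr0 mulr0.
Qed.

End ranking.

Section equivalences.
Context (R : realType) (I : set R) (lambda1 lambda2 : probability R R).
Hypothesis I0 : I !=set0.
Hypothesis oI : open I.
Hypothesis iI : is_interval I.
Hypothesis lambda1_I : carried_by lambda1 I.
Hypothesis lambda2_mean : finite_mean lambda2.
Context (n : nat).

Let mI : measurable I. Proof. exact: open_measurable. Qed.
Let A := support_in I lambda1.

Lemma admissible_integrable f g : admissible_pair I lambda2 A f g ->
  lambda2.-integrable I (EFin \o f).
Proof.
move=> [cf fneg _ _ _]; apply: concave_integrable => //.
exact: strictly_concave_concave.
Qed.

(** The atoms are enumerated by decreasing [g]; injectivity of [g] on them makes the decrease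
    strict, as the exchange argument requires. *)
Lemma nested_of_maximizing_pair J0 (nu : {measure set (R * R) -> \bar R}) f g :
  set_bij [set: 'I_n] A J0 -> admissible_pair I lambda2 A f g ->
  maximizing_transport I lambda1 lambda2 (tensor g f) nu ->
  exists J eta, nested_coupling I lambda1 lambda2 (n := n) J eta nu.
Proof.
move=> bij0 adm maxi; have intf := admissible_integrable adm.
have [cf _ mg _ injg] := adm.
have [s [bs sP]] : exists s : 'I_n -> 'I_n, bijective s /\
    forall i j : 'I_n, (i <= j)%N -> g (J0 (s j)) <= g (J0 (s i)).
  apply: (sorted_bijection (leI := fun i j => g (J0 j) <= g (J0 i))).
    by move=> i j; exact: le_total.
  by move=> j i k h1 h2; exact: le_trans h2 h1.
have bijJ := set_bij_comp_perm bs bij0.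
have [mart _] := maxi.
have [eta [fam nuE]] := fibers_of_coupling oI lambda1_I bijJ mart.
exists (J0 \o s), eta; split => //.
apply: (nested_of_maximizer oI iI lambda1_I lambda2_mean bijJ cf mg intf maxi fam nuE).
move=> i j ij; rewrite lt_neqAle sP 1?ltnW// andbT /=.
apply/eqP => /injg; rewrite !inE => /(_ _ _)/(atoms_inj bij0)/(bij_inj bs) E.
have inA k : A (J0 (s k)) by rewrite /A (atomsE bij0); exists (s k).
by move: ij; rewrite E// ltnn.
Qed.

Lemma uniquely_maximizing_of_nested J eta (nu : {measure set (R * R) -> \bar R}) :
  nested_coupling I lambda1 lambda2 (n := n) J eta nu ->
  exists f g, admissible_pair I lambda2 A f g /\
    uniquely_maximizing_transport I lambda1 lambda2 (tensor g f) nu.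
Proof.
move=> [bijJ fam nuE nest].
have injJ := atoms_inj bijJ.
pose f := @hyperbola R; pose g := ranking J.
have mf : measurable_fun setT f by exact: hyperbola_measurable.
have mEf : measurable_fun setT (EFin \o f) by exact/measurable_EFinP.
have intfT : lambda2.-integrable setT (EFin \o f).
  apply: (@slope_bounded_integrable _ lambda2) => //.
  exact: hyperbola_slope_bounded.
have intf : lambda2.-integrable I (EFin \o f) by exact: integrableS intfT.
have mg : measurable_fun I g by exact: ranking_measurable.
have cf : strictly_concave_on I f by exact: hyperbola_strictly_concave.
have transE theta (rho : {measure set (R * R) -> \bar R}) :
    transport_family I lambda1 lambda2 J theta -> fibered J rho theta ->
    (\int[rho]_(z in I `*` I) (tensor g f z)%:E =
     \sum_(i < n) (- i%:R)%:E * \int[theta i]_y (f y)%:E)%E.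
  move=> famr rhoE; have [thetaI _ _ _] := famr.
  rewrite (integral_tensor rhoE mI (atoms_in bijJ) mg (measurable_funTS mf)).
    apply: eq_bigr => i _; rewrite /g ranking_atom//.
    by rewrite (integral_carried mI (thetaI i) mEf).
  by move=> i; exact: family_integrable famr intf.
have maxnu : maximizing_transport I lambda1 lambda2 (tensor g f) nu.
  split; first exact: coupling_of_fibers fam nuE.
  move=> rho mart.
  have [theta [famr rhoE]] := fibers_of_coupling oI lambda1_I bijJ mart.
  rewrite (transE _ _ famr rhoE) (transE _ _ fam nuE).
  apply: (@family_optimal _ _ _ _ oI lambda1_I lambda2_mean _ _ bijJ eta theta f
    (fun i => - i%:R)) => //.
  - exact: hyperbola_concave.
  - exact: hyperbola_slope_bounded.
  - by move=> i; rewrite lerN2 ler_nat.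
exists f, g; split.
  split => //.
  - rewrite -ge0_fin_numE; last by apply: integral_ge0.
    exact (integrable_neg_fin_num mI intf).
  - exact: ranking_bounded.
  - move=> x y; rewrite /A (atomsE bijJ) !inE => -[i _ <-] [j _ <-].
    rewrite /g !ranking_atom// => /oppr_inj/eqP; rewrite eqr_nat => /eqP ij.
    by congr J; exact: val_inj.
(* Another maximizer for the same pair is nested along the same [J], hence has the same fibers. *)
split => // rho maxrho B mB.
have [mart _] := maxrho.
have [theta [famr rhoE]] := fibers_of_coupling oI lambda1_I bijJ mart.
have nestr : nested theta.
  apply: (nested_of_maximizer oI iI lambda1_I lambda2_mean bijJ cf mg intf
    maxrho famr rhoE) => i j ij.
  by rewrite /g !ranking_atom// ltrN2 ltr_nat.
rewrite rhoE// nuE//; apply: eq_bigr => i _.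
apply: (nested_unique I0 oI iI famr nestr fam nest).
exact: measurable_xsection.
Qed.

End equivalences.

Lemma support_bijection (R : realType) (A : set R) (n : nat) :
  (A #= `I_n)%card -> exists J : 'I_n -> R, set_bij [set: 'I_n] A J.
Proof.
rewrite card_eq_sym => /card_set_bijP[h [hfun hinj hsurj]].
exists (h \o val); split.
- by move=> i _; apply: hfun; exact: ltn_ord.
- move=> i j _ _ /= hij; apply: val_inj; apply: hinj hij; rewrite inE; exact: ltn_ord.
- by move=> x /hsurj[k kn <-]; exists (Ordinal kn).
Qed.

Theorem corollary2p20 (R : realType) (I : set R)
    (I_nonempty : I !=set0) (I_open : open I) (I_itv : is_interval I)
    (lambda1 lambda2 : probability R R)
    (lambda1_I : carried_by lambda1 I) (lambda2_I : carried_by lambda2 I)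
    (lambda1_mean : finite_mean lambda1) (lambda2_mean : finite_mean lambda2)
    (n : nat) (card_supp : (support_in I lambda1 #= `I_n)%card)
    (nu : {measure set (R * R) -> \bar R})
    (nu_I : carried_by nu (I `*` I)) :
  let A := support_in I lambda1 in
  [<-> curtain_martingale_coupling I lambda1 lambda2 nu;
       connected_part_decomposition I lambda1 lambda2 n A nu;
       exists f g : R -> R,
         admissible_pair I lambda2 A f g /\
         maximizing_transport I lambda1 lambda2 (tensor g f) nu;
       exists f g : R -> R,
         admissible_pair I lambda2 A f g /\
         uniquely_maximizing_transport I lambda1 lambda2 (tensor g f) nu].
Proof.
have [J0 bij0] := support_bijection card_supp.
move=> A; tfae.
- move=> /(nested_of_curtain I_open lambda1_I bij0)[J [eta nest]].
  exact: (decomposition_of_nested I_nonempty I_open I_itv nest).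
- move=> /(nested_of_decomposition I_nonempty I_open I_itv lambda1_I lambda2_I).
  move=> [J [eta nest]].
  have [f [g [adm [maxi _]]]] :=
    uniquely_maximizing_of_nested I_nonempty I_open I_itv lambda1_I lambda2_mean nest.
  by exists f, g.
(* The pair obtained here is a new one: only the nested structure survives from the given [f] and
   [g]. *)
- move=> [f [g [adm maxi]]].
  have [J [eta nest]] := nested_of_maximizing_pair I_nonempty I_open I_itv
    lambda1_I lambda2_mean bij0 adm maxi.
  exact: uniquely_maximizing_of_nested nest.
- move=> [f [g [adm [maxi _]]]].
  have [J [eta nest]] := nested_of_maximizing_pair I_nonempty I_open I_itv
    lambda1_I lambda2_mean bij0 adm maxi.
  exact: curtain_of_nested nest.
Qed.
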